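(* Let $a,b,k$ be integers with $b\ge a\ge 1$ and $k\ge 0$, and let $G$ be a connected graph of order $n\ge 2(b+a+k+2)(b+k+2)$ with minimum degree $\delta(G)\ge a+k$. If $\lambda(G)\ge \lambda(F_n^{a,b,k})$, then $G$ is a fractional $(a,b,k)$-critical graph, unless $G\cong F_n^{a,b,k}$.
   Context: All graphs are finite, simple and undirected. $\lambda(G)$ denotes the spectral radius (largest adjacency eigenvalue) of $G$. For positive integers $b\ge a$, a fractional $[a,b]$-factor of $G$ exists if there is a function $h:E(G)\to[0,1]$ with $a\le \sum_{e\ni v} h(e)\le b$ for every vertex $v$. A graph $G$ is fractional $(a,b,k)$-critical if for every set $X$ of $k$ vertices, $G-X$ has a fractional $[a,b]$-factor. $K_m$ is the complete graph, $\cup$ disjoint union, $\vee$ join, $(b+1)K_1$ the edgeless graph on $b+1$ vertices. $F_n^{a,b,k}$ is obtained from $K_{a+k}\vee\big(K_{n-(a+b+k+1)}\cup (b+1)K_1\big)$ by adding $a-1$ edges between one (fixed) vertex of $(b+1)K_1$ and $a-1$ vertices of $K_{n-(a+b+k+1)}$. *)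

(* Defs.v *)
From mathcomp Require Import all_boot all_order all_algebra.
From mathcomp Require Import classical_sets reals.

Set Implicit Arguments.
Unset Strict Implicit.
Unset Printing Implicit Defensive.

Import Order.TTheory GRing.Theory Num.Theory.

Record sgraph := SGraph {
  vertex :> finType;
  adj : rel vertex;
  adj_sym : symmetric adj;
  adj_irr : irreflexive adj }.

Definition edges (G : sgraph) : {set {set G}} :=
  [set [set p.1; p.2] | p : G * G & adj p.1 p.2].

Definition degree (G : sgraph) (v : G) : nat := #|[set w | adj v w]|.

(* The default value [#|G|] exceeds every degree, so it is only reached on the
   empty graph. *)
Definition min_degree (G : sgraph) : nat :=
  \big[minn/#|G|]_(v : G) degree v.

Definition connected_graph (G : sgraph) : Prop :=
  forall x y : G, connect (@adj G) x y.

Definition graph_iso (G H : sgraph) : Prop :=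
  exists2 f : G -> H, bijective f & {mono f : x y / adj x y}.

Section Induced.
Variables (G : sgraph) (S : {set G}).

Definition induced_adj (x y : {v : G | v \in S}) : bool := adj (val x) (val y).

Fact induced_sym : symmetric induced_adj.
Proof. by move=> x y; apply: adj_sym. Qed.

Fact induced_irr : irreflexive induced_adj.
Proof. by move=> x; apply: adj_irr. Qed.

Definition induced : sgraph := SGraph induced_sym induced_irr.
End Induced.

Definition delete (G : sgraph) (X : {set G}) : sgraph := induced (~: X).

Section Complete.
Variable m : nat.

Definition complete_adj (i j : 'I_m) : bool := i != j.

Fact complete_sym : symmetric complete_adj.
Proof. by move=> i j; rewrite /complete_adj eq_sym. Qed.

Fact complete_irr : irreflexive complete_adj.
Proof. by move=> i; rewrite /complete_adj eqxx. Qed.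

Definition complete : sgraph := SGraph complete_sym complete_irr.
End Complete.

Section Edgeless.
Variable m : nat.

Definition edgeless_adj (i j : 'I_m) : bool := false.

Fact edgeless_sym : symmetric edgeless_adj. Proof. by []. Qed.

Fact edgeless_irr : irreflexive edgeless_adj. Proof. by []. Qed.

Definition edgeless : sgraph := SGraph edgeless_sym edgeless_irr.
End Edgeless.

Section UnionJoin.
Variables G H : sgraph.

(* [c] is the adjacency between a vertex of [G] and a vertex of [H]. *)
Definition sum_adj (c : bool) (x y : G + H) : bool :=
  match x, y with
  | inl u, inl v => adj u v
  | inr u, inr v => adj u v
  | _, _ => c
  end.

Fact sum_sym c : symmetric (sum_adj c).
Proof. by move=> [u|u] [v|v] //=; apply: adj_sym. Qed.

Fact sum_irr c : irreflexive (sum_adj c).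
Proof. by move=> [u|u] /=; apply: adj_irr. Qed.

Definition disjoint_union : sgraph := SGraph (sum_sym false) (sum_irr false).

Definition join : sgraph := SGraph (sum_sym true) (sum_irr true).
End UnionJoin.

Section AddEdges.
Variables (G : sgraph) (r : rel G).

Definition add_adj (x y : G) : bool :=
  adj x y || (x != y) && (r x y || r y x).

Fact add_sym : symmetric add_adj.
Proof. by move=> x y; rewrite /add_adj adj_sym eq_sym orbC [r x y || _]orbC orbC. Qed.

Fact add_irr : irreflexive add_adj.
Proof. by move=> x; rewrite /add_adj adj_irr eqxx. Qed.

Definition add_edges : sgraph := SGraph add_sym add_irr.
End AddEdges.

Definition extremal_base (n a b k : nat) : sgraph :=
  join (complete (a + k))
       (disjoint_union (complete (n - (a + b + k + 1))) (edgeless b.+1)).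

(* The fixed vertex of the edgeless part is vertex 0; its additional neighbours
   are the first [a - 1] vertices of the second complete graph. *)
Definition extremal_new (n a b k : nat) : rel (extremal_base n a b k) :=
  fun x y =>
    match x, y with
    | inr (inr i), inr (inl j) => (i == ord0) && (j < a - 1)
    | _, _ => false
    end.

Definition extremal_graph (n a b k : nat) : sgraph :=
  add_edges (@extremal_new n a b k).

Section Spectrum.
Local Open Scope ring_scope.
Variable R : realType.

Definition adj_matrix (G : sgraph) : 'M[R]_#|G| :=
  \matrix_(i, j) (adj (enum_val i) (enum_val j))%:R.

(* An adjacency matrix is real symmetric, so for a nonempty graph its set of
   real eigenvalues is finite and nonempty, and [sup] is its maximum. *)
Definition spectral_radius (G : sgraph) : R :=
  sup [set x : R | eigenvalue (adj_matrix G) x]%classic.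
End Spectrum.

Section FractionalFactor.
Local Open Scope ring_scope.
Variable R : realType.

Definition has_fractional_factor (a b : nat) (G : sgraph) : Prop :=
  exists h : {set G} -> R,
    (forall e, e \in edges G -> 0 <= h e <= 1) /\
    (forall v : G, a%:R <= \sum_(e in edges G | v \in e) h e <= b%:R).

Definition fractional_critical (a b k : nat) (G : sgraph) : Prop :=
  forall X : {set G}, #|X| = k -> has_fractional_factor a b (delete X).
End FractionalFactor.

(* Main.v *)
(* If G - X has no fractional [a,b]-factor, minimising a sum of squared degree
   defects yields disjoint sets S, T in G - X with
   b|S| + sum_(v in T) d_(G-X-S)(v) < a|T|; the minimum degree then forces
   |T| > b. If |T| > b + 1, then G has too few edges: lambda(G)^2 is at most
   2e(G) - n + 1, which is below (n - b - 2)^2 <= lambda(F)^2. If |T| = b + 1,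
   the degrees of T all are at least c = a + k and their total excess over c is
   at most e = a - 1. Eliminating the entries outside T from the eigenvector
   equation of G gives inequalities for its entries on T. If no vertex of T
   carries the whole excess e, these inequalities produce a strictly
   subinvariant vector of F for lambda(G), so lambda(G) < lambda(F). Otherwise
   they produce a subinvariant one, and lambda(F) <= lambda(G) turns all of
   them into equalities, which identifies G with F. *)
Require Import Defs.
From mathcomp Require Import all_boot all_order all_algebra.
From mathcomp Require Import classical_sets reals.
From mathcomp Require Import boolp topology normedtype derive function_spaces.
From mathcomp Require Import ring lra zify.

Set Implicit Arguments.
Unset Strict Implicit.
Unset Printing Implicit Defensive.

Import Order.TTheory GRing.Theory Num.Theory numFieldNormedType.Exports.
Local Open Scope ring_scope.

(** [G] need be neither a subgraph nor a supergraph of the extremal graph: [T] may contain edges,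
    and its neighbourhoods may be arbitrary. So the comparison rests only on the fact that
    [(l + 1) * x u] is the sum of the Perron vector over the closed neighbourhood of [u]. Summed
    over the neighbours of [v], this bounds [l * (l + 1) * x v] by about [degree v] times the weight
    outside [T]; the equation for that weight then shows that [l + 1] exceeds the number of vertices
    outside [T] by at most about the sum of [degree v ^ 2] over [T], divided by [l * (l + 1)]. The
    sum of squares is convex: it is largest when one vertex carries the whole excess, and otherwise
    smaller by at least [e]. The lower bound on [n] makes [l * (l + 1)] so large that lower-order
    terms cannot make up for this loss. When one vertex does carry the excess, there is no loss to
    spend, and the second-order terms must be kept exactly by counting common neighbours. *)

(** * Minimisation over boxes *)

Section Minimum.
Local Open Scope classical_set_scope.
Variables (R : realType) (I : eqType).
Implicit Types (f g : {ptws I -> R} -> R).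

Lemma ptws_proj_continuous (i : I) : continuous (fun x : {ptws I -> R} => x i).
Proof. exact: (@proj_continuous I (fun=> R) i). Qed.

Lemma ptws_continuousM f g : continuous f -> continuous g -> continuous (fun x => f x * g x).
Proof. by move=> cf cg x; exact: (cvgM (cf x) (cg x)). Qed.

Lemma ptws_continuousN f : continuous f -> continuous (fun x => - f x).
Proof. by move=> cf x; exact: (cvgN (cf x)). Qed.

Lemma ptws_continuousD f g : continuous f -> continuous g -> continuous (fun x => f x + g x).
Proof. by move=> cf cg x; exact: (cvgD (cf x) (cg x)). Qed.

Lemma continuous_sumr (J : Type) (r : seq J) (P : pred J) (F : J -> {ptws I -> R} -> R) :
  (forall j, P j -> continuous (F j)) ->
  continuous (fun x => \sum_(j <- r | P j) F j x).
Proof. by apply: continuous_big; exact: add_continuous. Qed.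

(** The box is compact by Tychonoff, hence so is its intersection with [D]. The set [D] is the unit
    sphere for Perron vectors and the whole space for fractional factors. *)
Lemma box_min (l u : I -> R) (D : set {ptws I -> R}) f :
  closed D -> continuous f ->
  (exists2 x : I -> R, D x & forall i, l i <= x i <= u i) ->
  exists x : I -> R, [/\ D x, forall i, l i <= x i <= u i &
    forall y : I -> R, D y -> (forall i, l i <= y i <= u i) -> f x <= f y].
Proof.
move=> cD cf [x0 Dx0 x0B].
pose B := [set x : {ptws I -> R} | forall i, `[l i, u i]%classic (x i)].
have inB (x : {ptws I -> R}) : B x <-> forall i, l i <= x i <= u i.
  by rewrite /B /=; split=> h i; move: (h i); rewrite in_itv.
have cB : compact B.
  have cI (i : I) : compact `[l i, u i]%classic by exact: segment_compact.
  exact: (@tychonoff I (fun=> R) _ cI).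
have [||x] := @compact_EVT_min _ R f (B `&` D) _ (compact_closedI cB cD).
- by exists x0; split=> //; apply/inB.
- exact: continuous_subspaceT.
rewrite inE => -[/inB Bx Dx] xmin; exists x; split=> // y Dy yB.
by apply: xmin; rewrite inE; split=> //; apply/inB.
Qed.
End Minimum.

(** * Perron vectors and Rayleigh quotients of graphs *)

Section Perron.
Variables (R : realType) (G : sgraph).
Implicit Types (w x y z : G -> R).

Definition adj_form x y : R := \sum_u x u * \sum_(v | adj u v) y v.

Lemma adj_formC x y : adj_form x y = adj_form y x.
Proof.
rewrite /adj_form.
under eq_bigr do rewrite big_distrr /=.
rewrite (exchange_big_dep predT) //=; apply: eq_bigr => v _.
rewrite big_distrr /=; apply: eq_big => [u|u _]; first by rewrite adj_sym.
by rewrite mulrC.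
Qed.

Lemma adj_formDl x y z : adj_form (fun u => x u + y u) z = adj_form x z + adj_form y z.
Proof. by rewrite -big_split; apply: eq_bigr => u _; rewrite mulrDl. Qed.

Lemma adj_formZl c x y : adj_form (fun u => c * x u) y = c * adj_form x y.
Proof. by rewrite [RHS]big_distrr; apply: eq_bigr => u _; rewrite /= mulrA. Qed.

Lemma adj_form_norm x : adj_form x x <= adj_form (fun u => `|x u|) (fun u => `|x u|).
Proof.
apply: ler_sum => u _; rewrite !big_distrr; apply: ler_sum => v _ /=.
by rewrite -normrM ler_norm.
Qed.

Lemma sum_indicator (u : G) (F : G -> R) : \sum_v (v == u)%:R * F v = F u.
Proof.
rewrite (bigD1 u) //= eqxx mul1r big1 ?addr0 // => v /negbTE->.
by rewrite mul0r.
Qed.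

(** The vector maximises [adj_form] on the nonnegative part of the unit sphere. Its value bounds the
    form at every [w], since passing to absolute values cannot decrease the form and a unit vector
    has entries at most 1. *)
Lemma perron_exists : (0 < #|G|)%N ->
  exists rho x, [/\ forall u, 0 <= x u, exists u, 0 < x u,
    forall u, rho * x u = \sum_(v | adj u v) x v
    & forall w, adj_form w w <= rho * \sum_u w u ^+ 2].
Proof.
move=> /card_gt0P[g0 _].
pose f (x : {ptws G -> R}) := - adj_form x x.
pose D : set {ptws G -> R} := [set x | \sum_u x u ^+ 2 = 1]%classic.
have cA u : continuous (fun x : {ptws G -> R} => \sum_(v | adj u v) x v).
  exact: (continuous_sumr (F := fun v x => x v)) (fun v _ => @ptws_proj_continuous R G v).
have cf : continuous f.
  apply: ptws_continuousN.
  apply: (continuous_sumr (F := fun u x => x u * \sum_(v | adj u v) x v)) => u _.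
  by apply: ptws_continuousM; [exact: ptws_proj_continuous | exact: cA].
have cD : closed D.
  have -> : D = ((fun x : {ptws G -> R} => \sum_u x u ^+ 2) @^-1` [set x | x = 1])%classic by [].
  apply: preimage_closed; last exact: closed_eq.
  move=> x _; move: x; apply: (continuous_sumr (F := fun u x => x u ^+ 2)) => u _.
  by apply: ptws_continuousM; exact: ptws_proj_continuous.
have [|x [xD xB xmax]] := @box_min R G (fun=> 0) (fun=> 1) D f cD cf.
  exists (fun u => (u == g0)%:R) => [|u]; last by case: eqP; rewrite ?lexx ?ler01.
  rewrite /D /=; under eq_bigr do rewrite expr2.
  by rewrite sum_indicator eqxx.
pose rho := adj_form x x.
have x0 u : 0 <= x u by have /andP[] := xB u.
have rho0 : 0 <= rho.
  by apply: sumr_ge0 => u _; apply: mulr_ge0 => //; apply: sumr_ge0.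
have rhoP w : adj_form w w <= rho * \sum_u w u ^+ 2.
  set s := \sum_u w u ^+ 2.
  have s0 : 0 <= s by apply: sumr_ge0 => u _; exact: sqr_ge0.
  have ws u : `|w u| ^+ 2 <= s.
    rewrite real_normK ?num_real // /s (bigD1 u) //= lerDl.
    by apply: sumr_ge0 => v _; exact: sqr_ge0.
  apply: le_trans (adj_form_norm w) _.
  have [s_0|s_neq0] := eqVneq s 0.
    rewrite s_0 mulr0 /adj_form big1 // => u _.
    have /eqP : `|w u| = 0.
      by apply/eqP; rewrite -sqrf_eq0 eq_le -{1}s_0 ws sqr_ge0.
    by move/eqP->; rewrite mul0r.
  have sp : 0 < s by rewrite lt_def s_neq0.
  pose r := Num.sqrt s.
  have rp : 0 < r by rewrite sqrtr_gt0.
  have r2 : r ^+ 2 = s by rewrite sqr_sqrtr.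
  pose y : G -> R := fun u => r^-1 * `|w u|.
  have := xmax y.
  rewrite /f lerN2.
  have yE : adj_form y y = s^-1 * adj_form (fun u => `|w u|) (fun u => `|w u|).
    by rewrite adj_formZl adj_formC adj_formZl mulrA -r2 expr2 invfM.
  rewrite yE -/rho mulrC ler_pdivrMr //; apply.
    rewrite /D /= /y; under eq_bigr do rewrite exprMn real_normK ?num_real //.
    by rewrite -big_distrr /= exprVn r2 mulVf.
  move=> u; rewrite /y mulr_ge0 ?invr_ge0 ?(ltW rp) //= mulrC ler_pdivrMr // mul1r.
  by rewrite -(ler_pXn2r (n := 2)) ?nnegrE ?(ltW rp) // r2.
exists rho, x; split => //.
  have [h|/forallNP h] := pselect (exists u, 0 < x u); first exact: h.
  move: xD; rewrite /D /= big1 => [/esym/eqP|u _]; first by rewrite oner_eq0.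
  have /eqP : x u = 0 by apply/eqP; rewrite eq_le x0 andbT leNgt; apply/negP/h.
  by move/eqP->; rewrite expr0n.
(* The nonnegative form [rho |w|^2 - w A w] vanishes at [x]; its variation in
   the direction of the indicator of [u] must vanish too. *)
move=> u; set c := \sum_(v | _) _; set d : G -> R := fun v => (v == u)%:R.
have dx : adj_form d x = c by rewrite /adj_form sum_indicator.
have dd : adj_form d d = 0.
  rewrite /adj_form sum_indicator big1 // => v; rewrite /d.
  by case: eqP => // ->; rewrite adj_irr.
have var t : 2 * t * c <= rho * (2 * t * x u + t ^+ 2).
  have := rhoP (fun v => x v + t * d v).
  rewrite adj_formDl adj_formZl [adj_form x _]adj_formC [adj_form d _]adj_formC.
  rewrite !adj_formDl !adj_formZl [adj_form x d]adj_formC dx dd -/rho.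
  have -> : \sum_v (x v + t * d v) ^+ 2 = 1 + (2 * t * x u + t ^+ 2).
    have dE v : (x v + t * d v) ^+ 2 = x v ^+ 2 + d v * (2 * t * x v + t ^+ 2).
      by rewrite /d; case: eqP => _ /=; ring.
    under eq_bigr do rewrite dE.
    by rewrite big_split /= sum_indicator xD.
  by move=> h; lra.
have rp : 0 < rho + 1 by lra.
(* With [e = rho * x u - c], the choice [t = - e / (rho + 1)] turns [var] into
   [(rho + 2) * e ^+ 2 <= 0]. The shift by 1 keeps the denominator positive when [rho = 0]. *)
have := var (- (rho * x u - c) / (rho + 1)).
set e := rho * x u - c; rewrite -(ler_pM2r (x := (rho + 1) ^+ 2)) ?exprn_gt0 //.
have -> : 2 * (- e / (rho + 1)) * c * (rho + 1) ^+ 2 = - 2 * e * c * (rho + 1).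
  by field; lra.
have -> : rho * (2 * (- e / (rho + 1)) * x u + (- e / (rho + 1)) ^+ 2) * (rho + 1) ^+ 2
   = - 2 * e * (rho * x u) * (rho + 1) + rho * e ^+ 2.
  by field; lra.
have -> : rho * x u = e + c by rewrite /e; ring.
move=> h; have e2 : e ^+ 2 <= 0.
  have := sqr_ge0 e; nra.
by have : e = 0; [apply/eqP; rewrite -sqrf_eq0 eq_le e2 sqr_ge0 | rewrite /e; lra].
Qed.

(** Eigenvectors of matrices are rows here; the symmetry of [adj] lets them be read as functions on
    the vertices. *)
Lemma eigenvalueP_graph (a : R) :
  reflect (exists2 x : G -> R, exists u, x u != 0 & forall u, a * x u = \sum_(v | adj u v) x v)
    (eigenvalue (adj_matrix R G) a).
Proof.
have sumE (F : G -> R) (P : pred G) :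
    \sum_(v | P v) F v = \sum_(i < #|G|) (P (enum_val i))%:R * F (enum_val i).
  rewrite (reindex_onto (enum_val : 'I_#|G| -> G) enum_rank) /=; last first.
    by move=> v _; rewrite enum_rankK.
  rewrite (eq_bigl (fun i => P (enum_val i))); last by move=> i; rewrite enum_valK eqxx andbT.
  by rewrite big_mkcond /=; apply: eq_bigr => i _; case: (P _); rewrite ?mul1r ?mul0r.
apply: (iffP eigenvalueP) => [[v vE v0]|[x [u xu] xE]].
  exists (fun u => v ord0 (enum_rank u)) => [|u].
    apply/existsP; apply: contraNT v0; rewrite negb_exists => /forallP v0.
    by apply/eqP/rowP => i; rewrite mxE; move/negPn/eqP: (v0 (enum_val i)); rewrite enum_valK.
  move/rowP/(_ (enum_rank u)): vE; rewrite !mxE => <-.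
  rewrite sumE; apply: eq_bigr => i _; rewrite !mxE enum_rankK enum_valK.
  by rewrite adj_sym mulrC.
exists (\row_i x (enum_val i)); last first.
  apply: contraNneq xu => /rowP/(_ (enum_rank u)); rewrite !mxE enum_rankK => ->.
  by rewrite eqxx.
apply/rowP => i; rewrite !mxE xE sumE; apply: eq_bigr => j _.
by rewrite !mxE adj_sym mulrC.
Qed.

(** The value [rho] is an eigenvalue, and the quadratic bound tested on any eigenvector shows that
    no eigenvalue is larger, so the supremum is attained at [rho]. *)
Lemma perron : (0 < #|G|)%N ->
  exists x, [/\ forall u, 0 <= x u, exists u, 0 < x u,
    forall u, spectral_radius R G * x u = \sum_(v | adj u v) x v
    & forall w, adj_form w w <= spectral_radius R G * \sum_u w u ^+ 2].
Proof.
move=> G0; have [rho [x [x0 xp xE rhoP]]] := perron_exists G0.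
suff -> : spectral_radius R G = rho by exists x.
have eig : eigenvalue (adj_matrix R G) rho.
  by apply/eigenvalueP_graph; exists x => //; case: xp => u xu; exists u; rewrite gt_eqF.
have ub : ubound [set a : R | eigenvalue (adj_matrix R G) a]%classic rho.
  move=> a /= /eigenvalueP_graph[y [u yu] yE].
  have yp : 0 < \sum_u y u ^+ 2.
    rewrite (bigD1 u) //= ltr_wpDr ?sumr_ge0 // => [v _|]; first exact: sqr_ge0.
    by rewrite lt_def sqrf_eq0 yu sqr_ge0.
  rewrite -(ler_pM2r yp) (le_trans _ (rhoP y)) // big_distrr /=.
  by apply: ler_sum => v _; rewrite -yE expr2 mulrCA.
apply/eqP; rewrite eq_le; apply/andP; split.
  by apply: ge_sup => //; exists rho.
by apply: ub_le_sup => //; exists rho.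
Qed.

Hypothesis G_gt0 : (0 < #|G|)%N.

(** Weighting the inequalities by [y] and summing gives a Rayleigh quotient of at least [l]. *)
Lemma subinvariant_le (l : R) y : (forall u, 0 <= y u) -> (exists u, 0 < y u) ->
  (forall u, l * y u <= \sum_(v | adj u v) y v) -> l <= spectral_radius R G.
Proof.
move=> y0 [u yu] ly; have [_ [_ _ _ rhoP]] := perron G_gt0.
have yp : 0 < \sum_u y u ^+ 2.
  rewrite (bigD1 u) //= ltr_wpDr ?exprn_gt0 ?sumr_ge0 // => v _; exact: sqr_ge0.
rewrite -(ler_pM2r yp) (le_trans _ (rhoP y)) // big_distrr /=.
by apply: ler_sum => v _; rewrite expr2 mulrCA ler_wpM2l.
Qed.

Lemma subinvariant_lt (l : R) y : (forall u, 0 <= y u) ->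
  (forall u, l * y u <= \sum_(v | adj u v) y v) ->
  (exists2 u, 0 < y u & l * y u < \sum_(v | adj u v) y v) -> l < spectral_radius R G.
Proof.
move=> y0 ly [u yu lyu]; have [_ [_ _ _ rhoP]] := perron G_gt0.
have yp : 0 < \sum_u y u ^+ 2.
  rewrite (bigD1 u) //= ltr_wpDr ?exprn_gt0 ?sumr_ge0 // => v _; exact: sqr_ge0.
rewrite -(ltr_pM2r yp) (lt_le_trans _ (rhoP y)) // big_distrr /= /adj_form.
rewrite [X in X < _](bigD1 u) //= [X in _ < X](bigD1 u) //=.
apply: ltr_leD; first by rewrite expr2 mulrCA ltr_pM2l.
by apply: ler_sum => v _; rewrite expr2 mulrCA ler_wpM2l.
Qed.

(** At a zero of a nonnegative eigenvector all neighbours vanish too, so by connectedness one zero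
    would make the vector zero. *)
Lemma perron_connected : connected_graph G ->
  exists2 x : G -> R, forall u, 0 < x u &
    forall u, spectral_radius R G * x u = \sum_(v | adj u v) x v.
Proof.
move=> conn; have [x [x0 [g xg] xE _]] := perron G_gt0.
exists x => // u; rewrite lt_def x0 andbT.
pose P : pred G := fun v => x v == 0.
have clP : fingraph.closed (@adj G) P.
  apply: intro_closed => [|v w vw]; first exact/sym_connect_sym/adj_sym.
  rewrite !unfold_in => /eqP xv; move: (xE v); rewrite xv mulr0 => /esym/eqP.
  by rewrite psumr_eq0 // => /allP/(_ w (mem_index_enum _)); rewrite vw implyTb.
apply/negP => xu; have := closed_connect clP (conn u g).
by rewrite !unfold_in xu gt_eqF.
Qed.
End Perron.

(** * A sufficient condition for fractional factors *)

Section FactorTheorem.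
Variables (R : realType) (G : sgraph).

Lemma sum_incident_edges (v : G) (h : {set G} -> R) :
  \sum_(e in edges G | v \in e) h e = \sum_(w | adj v w) h [set v; w].
Proof.
have -> : \sum_(w | adj v w) h [set v; w] = \sum_(w in [set w | adj v w]) h [set v; w].
  by apply: eq_bigl => w; rewrite inE.
rewrite -(big_imset (h := fun w => [set v; w]) h) /=; last first.
  move=> w1 w2; rewrite !inE => vw1 vw2 /setP/(_ w1); rewrite !inE eqxx orbT.
  case: (eqVneq w1 v) => [w1v|_ /esym/orP[]//]; last by move/eqP.
  by rewrite w1v adj_irr in vw1.
apply: eq_bigl => e; apply/andP/imsetP => [[/imsetP[[p q] /= pq ->]]|[w]].
  rewrite !inE in pq *; case/orP => /eqP->; first by exists q; rewrite ?inE.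
  by exists p; rewrite ?inE 1?adj_sym // finset.setUC.
rewrite inE => vw ->; rewrite !inE eqxx; split=> //.
by apply/imsetP; exists (v, w); rewrite ?inE.
Qed.

Lemma fractional_factor_exists (a b : nat) : (a <= b)%N ->
  (forall S T : {set G}, [disjoint S & T] ->
    (a * #|T| <= b * #|S| + \sum_(v in T) #|[set w | adj v w & w \notin S]|)%N) ->
  has_fractional_factor R a b G.
Proof.
move=> ab cond.
(* A fractional factor is a zero of [f]; at a minimiser the sign pattern of the
   residuals [r] yields sets [S] and [T] for which [cond] forces [r = 0]. *)
pose I := ({set G} + G)%type.
pose f (x : {ptws I -> R}) :=
  \sum_v (x (inr v) - \sum_(e in edges G | v \in e) x (inl e)) ^+ 2.
(* Besides a weight in [[0, 1]] for each edge, every vertex carries a free target in [[a, b]], which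
   encodes the two-sided degree constraint as a box. *)
pose l (i : I) : R := if i is inl _ then 0 else a%:R.
pose u (i : I) : R := if i is inl _ then 1 else b%:R.
have lu i : l i <= u i by case: i => [e|v] /=; rewrite ?ler01 ?ler_nat.
have inrE (v w : G) : (inr v == inr w :> I) = (v == w) by apply/eqP/eqP => [[]|->].
have inlE (e e' : {set G}) : (inl e == inl e' :> I) = (e == e').
  by apply/eqP/eqP => [[]|->].
have cf : continuous f.
  apply: (continuous_sumr (F := fun v x =>
    (x (inr v) - \sum_(e in edges G | v \in e) x (inl e)) ^+ 2)) => v _.
  suff c : continuous (fun x : {ptws I -> R} =>
      x (inr v) - \sum_(e in edges G | v \in e) x (inl e)).
    by apply: ptws_continuousM; exact: c.
  apply: (ptws_continuousD (f := fun x => x (inr v))); first exact: ptws_proj_continuous.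
  apply: ptws_continuousN.
  apply: (continuous_sumr (F := fun e x => x (inl e))) => e _.
  exact: ptws_proj_continuous.
have [|x [_ xB xmin]] := @box_min R I l u setT f closedT cf.
  by exists l => // i; rewrite lexx lu.
pose deg v := \sum_(e in edges G | v \in e) x (inl e).
pose r v := x (inr v) - deg v.
pose upd i t (j : I) := if j == i then t else x j.
have updB i t : l i <= t <= u i -> f x <= f (upd i t).
  by move=> ht; apply: xmin => // j; rewrite /upd; case: eqP => [->|_].
have varP v t : a%:R <= t <= b%:R -> r v ^+ 2 <= (t - deg v) ^+ 2.
  move=> ht; have := updB (inr v) t ht.
  rewrite /f (bigD1 v) //= [X in _ <= X -> _](bigD1 v) //=.
  have -> : \sum_(e in edges G | v \in e) upd (inr v) t (inl e) = deg v by [].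
  rewrite {1}/upd eqxx -lerBrDr => /le_trans -> //.
  rewrite [X in _ + X - _](eq_bigr (fun w => r w ^+ 2)); last first.
    move=> w /negbTE wv; congr (_ ^+ 2); rewrite /upd /=.
    by rewrite inrE wv.
  by rewrite addrK.
(* Changing the weight of [pq] by [d] changes [f] by [2 * d * (d - (r p + r q))], which cannot be
   negative at a minimiser. *)
have varE p q t : adj p q -> 0 <= t <= 1 ->
    0 <= (t - x (inl [set p; q])) * (t - x (inl [set p; q]) - (r p + r q)).
  move=> pq ht; set e := [set p; q]; set d := t - x (inl e).
  have eE : e \in edges G by apply/imsetP; exists (p, q); rewrite ?inE.
  have pqN : p != q by apply: contraTneq pq => ->; rewrite adj_irr.
  have := updB (inl e) t ht; rewrite -subr_ge0 /f -sumrB.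
  rewrite (eq_bigr (fun w => if w \in e then d ^+ 2 - 2 * d * r w else 0)) => [|w _].
    rewrite -big_mkcond /= big_setU1 ?inE //= big_set1 => h.
    by rewrite /d in h *; lra.
  set s := \sum_(e0 in _ | _) upd _ _ _; have -> : s = deg w + (w \in e)%:R * d.
    rewrite /s /deg; case: (boolP (w \in e)) => we.
      rewrite (bigD1 e) ?eE ?we //= [in RHS](bigD1 e) ?eE ?we //=.
      rewrite {1}/upd eqxx (eq_bigr (fun e => x (inl e))) => [|e' /andP[_ /negbTE ee]].
        by rewrite /d; ring.
      by rewrite /upd inlE ee.
    rewrite mul0r addr0; apply: eq_bigr => e' /andP[_ we'].
    rewrite /upd inlE; case: eqP => // ee.
    by rewrite ee (negbTE we) in we'.
  have -> : upd (inl e) t (inr w) = x (inr w) by [].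
  by rewrite -/(deg w) /r; case: (w \in e); rewrite ?mul1r ?mul0r ?addr0 /=; ring.
have xv v : a%:R <= x (inr v) <= b%:R := xB (inr v).
have xe e : 0 <= x (inl e) <= 1 := xB (inl e).
have abR : (a%:R : R) <= b%:R by rewrite ler_nat.
(* A target above the attained degree could be lowered, decreasing [f], unless it already sits at
   [a]. *)
have r_gt0 v : 0 < r v -> x (inr v) = a%:R.
  move=> rv; have /andP[av vb] := xv v.
  apply/eqP; rewrite eq_le av andbT leNgt; apply/negP => va.
  case: (lerP a%:R (deg v)) => [adv|dva].
    have /(varP v) : a%:R <= deg v <= b%:R.
      by rewrite adv /= (le_trans _ vb) // -subr_ge0 ltW.
    by rewrite subrr expr0n /=; nra.
  have h := varP v a%:R; rewrite lexx abR in h; move/(_ isT): h => h.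
  by rewrite /r in rv h; nra.
have r_lt0 v : r v < 0 -> x (inr v) = b%:R.
  move=> rv; have /andP[av vb] := xv v.
  apply/eqP; rewrite eq_le vb /= leNgt; apply/negP => va.
  case: (lerP (deg v) b%:R) => [adv|dva].
    have /(varP v) : a%:R <= deg v <= b%:R.
      by rewrite adv andbT (le_trans av) // -subr_le0 ltW.
    by rewrite subrr expr0n /=; nra.
  have h := varP v b%:R; rewrite lexx abR in h; move/(_ isT): h => h.
  by rewrite /r in rv h; nra.
(* Raising the weight by [(r p + r q) / 2], or up to 1 if that is less, would decrease [f]. *)
have e_gt0 p q : adj p q -> 0 < r p + r q -> x (inl [set p; q]) = 1.
  move=> pq s0; have /andP[h0 h1] := xe [set p; q]; set h := x _ in h0 h1 *.
  apply/eqP; rewrite eq_le h1 /= leNgt; apply/negP => h_lt1.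
  case: (lerP (1 - h) ((r p + r q) / 2)) => hr.
    by have := varE p q 1 pq; rewrite -/h ler01 lexx => /(_ isT); nra.
  have := varE p q (h + (r p + r q) / 2) pq; rewrite -/h.
  have -> : 0 <= h + (r p + r q) / 2 <= 1 by lra.
  by move=> /(_ isT); nra.
have e_lt0 p q : adj p q -> r p + r q < 0 -> x (inl [set p; q]) = 0.
  move=> pq s0; have /andP[h0 h1] := xe [set p; q]; set h := x _ in h0 h1 *.
  apply/eqP; rewrite eq_le h0 andbT leNgt; apply/negP => h_gt0.
  case: (lerP h (- ((r p + r q) / 2))) => hr.
    by have := varE p q 0 pq; rewrite -/h ler01 lexx => /(_ isT); nra.
  have := varE p q (h + (r p + r q) / 2) pq; rewrite -/h.
  have -> : 0 <= h + (r p + r q) / 2 <= 1 by lra.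
  by move=> /(_ isT); nra.
pose T := [set v | 0 < r v]; pose S := [set v | r v < 0].
have dST : [disjoint S & T].
  by rewrite -finset.setI_eq0; apply/eqP/setP => v; rewrite !inE; case: ltgtP.
have degE v : deg v = \sum_(w | adj v w) x (inl [set v; w]).
  exact: sum_incident_edges v (fun e => x (inl e)).
have sumT : \sum_(v in T) deg v = (\sum_(v in T) #|[set w | adj v w & w \notin S]|)%:R
    + \sum_(v in T) \sum_(w in S | adj v w) x (inl [set v; w]).
  rewrite natr_sum -big_split; apply: eq_bigr => v; rewrite inE => vT /=.
  rewrite degE (bigID (mem S)) /= addrC; congr (_ + _).
    rewrite (eq_bigr (fun=> 1)) => [|w /andP[vw]].
      by rewrite -sum1_card natr_sum; apply: eq_bigl => w; rewrite !inE.
    by rewrite inE -leNgt => wS; apply: e_gt0 => //; rewrite ltr_pwDl.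
  by apply: eq_bigl => w; rewrite andbC.
have sumS : \sum_(v in S) deg v =
    \sum_(v in T) \sum_(w in S | adj v w) x (inl [set v; w]).
  rewrite (exchange_big_dep (mem S)) /=; last by move=> v w _ /andP[].
  apply: eq_bigr => v vS; rewrite degE (bigID (mem T)) /= addrC big1 => [|w /andP[vw]].
    rewrite add0r; apply: eq_big => [w|w /andP[vw _]]; last by rewrite finset.setUC.
    by rewrite vS adj_sym andbC.
  by move: vS; rewrite !inE -leNgt => vS wT; apply: e_lt0 => //; lra.
(* Edges from [T] to the complement of [S] have weight 1 and edges from [S] to the complement of [T]
   weight 0. The weights between [S] and [T] occur in both sums and cancel, which leaves [cond]. *)
have rsum : \sum_(v in T) r v + \sum_(v in S) - r v <= 0.
  rewrite (eq_bigr (fun v => a%:R - deg v)); last first.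
    by move=> v; rewrite inE => /r_gt0 <-.
  rewrite [X in _ + X](eq_bigr (fun v => deg v - b%:R)); last first.
    by move=> v; rewrite inE => /r_lt0 <-; rewrite opprB.
  rewrite !sumrB sumT sumS !sumr_const -!mulrnA.
  have := cond S T dST; rewrite -(ler_nat R) natrD => h; lra.
have T0 : 0 <= \sum_(v in T) r v by apply: sumr_ge0 => v; rewrite inE => /ltW.
have S0 : 0 <= \sum_(v in S) - r v.
  by apply: sumr_ge0 => v; rewrite inE oppr_ge0 => /ltW.
have r0 v : r v = 0.
  apply/eqP; rewrite eq_le !leNgt; apply/andP; split; apply/negP => rv.
    have : r v <= \sum_(v in T) r v.
      rewrite (bigD1 v) ?inE //= lerDl; apply: sumr_ge0 => w.
      by rewrite inE => /andP[/ltW].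
    by lra.
  have : - r v <= \sum_(v in S) - r v.
    rewrite (bigD1 v) ?inE //= lerDl; apply: sumr_ge0 => w.
    by rewrite inE oppr_ge0 => /andP[/ltW].
  by lra.
exists (fun e => x (inl e)); split=> [e _|v]; first exact: xe.
by have := xv v; have := r0 v; rewrite /r -/(deg v); move/subr0_eq->.
Qed.
End FactorTheorem.

(** * Transfer of a violating pair from [G - X] to [G] *)

Section Witness.
Local Open Scope nat_scope.
Variables (R : realType) (G : sgraph).

Lemma degree_ge_min_degree (v : G) : min_degree G <= degree v.
Proof.
rewrite /min_degree; elim: (index_enum _) (mem_index_enum v) => //= u r IHr.
rewrite inE big_cons geq_min => /predU1P[<-|/IHr->]; first by rewrite leqnn.
by rewrite orbT.
Qed.

(** Deleting [X] and [S] costs a vertex of [T] at most [k + s] neighbours, so the violation becomes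
    a bound on degrees in [G]. Of [S], only its size [s] is needed later. *)
Lemma not_critical_witness (a b k : nat) : a <= b -> ~ fractional_critical R a b k G ->
  exists (T : {set G}) (s : nat), [/\ s + k + #|T| <= #|G|, b * s < a * #|T|
    & \sum_(v in T) degree v + b * s < (s + k + a) * #|T|].
Proof.
move=> ab /existsNP[X /not_implyP[cX nf]].
have [S [T [dST viol]]] : exists S T : {set delete X}, [disjoint S & T] /\
    b * #|S| + \sum_(v in T) #|[set w | adj v w & w \notin S]| < a * #|T|.
  apply: contra_notP nf => /forallNP nST.
  apply: fractional_factor_exists => // S T dST; rewrite leqNgt; apply/negP => h.
  by apply: (nST S); exists T.
pose v0 : delete X -> G := val.
have v0I : injective v0 := val_inj.
have v0X v : v0 v \notin X by have := valP v; rewrite inE.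
pose S1 := v0 @: S; pose T1 := v0 @: T.
have cS : #|S1| = #|S| by rewrite card_imset.
have cT : #|T1| = #|T| by rewrite card_imset.
exists T1, #|S|; rewrite cT; split.
- rewrite -cS -cX -cT.
  have d1 : S1 :&: X = finset.set0.
    by apply/setP => v; rewrite !inE; apply/negP => /andP[/imsetP[w _ ->]]; apply/negP.
  have d2 : (S1 :|: X) :&: T1 = finset.set0.
    apply/setP => v; rewrite !inE; apply/negP => /andP[/orP[]].
      move=> /imsetP[w wS ->] /imsetP[w' w'T] /v0I ww'.
      by move: dST => /pred0P/(_ w); rewrite /= wS ww' w'T.
    by move=> vX /imsetP[w _ vw]; have := v0X w; rewrite -vw vX.
  have := cardsUI S1 X; have := cardsUI (S1 :|: X) T1.
  rewrite d1 d2 cards0 !addn0 => h2 h1; rewrite -h1 -h2; exact: max_card.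
- by apply: leq_ltn_trans viol; exact: leq_addr.
have degT (v : delete X) : degree (v0 v) <= #|S| + k + #|[set w | adj v w & w \notin S]|.
  rewrite -cX -cS.
  apply: leq_trans (_ : #|(S1 :|: X) :|: v0 @: [set w | adj v w & w \notin S]| <= _).
    apply: subset_leq_card; apply/fintype.subsetP => w; rewrite !inE => vw.
    case: (boolP (w \in X)) => [|wX]; first by rewrite orbT.
    have wX' : w \in ~: X by rewrite inE.
    pose w' : delete X := exist _ w wX'.
    have -> : w = v0 w' by [].
    rewrite !mem_imset // !inE orbF; case: (w' \in S) => //=.
    by rewrite andbT.
  apply: leq_trans (leq_card_setU _ _) _; apply: leq_add.
    by rewrite leq_card_setU.
  by rewrite card_imset.
rewrite big_imset /=; last by move=> x y _ _; exact: v0I.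
have : \sum_(v in T) degree (v0 v) <=
    \sum_(v in T) (#|S| + k + #|[set w | adj v w & w \notin S]|).
  by apply: leq_sum => v _; exact: degT.
rewrite big_split /= sum_nat_const mulnC [(_ + a) * _]mulnDl => h.
apply: leq_ltn_trans (leq_add h (leqnn _)) _.
by rewrite -addnA ltn_add2l addnC.
Qed.
End Witness.

(** * Recognising the extremal graph *)

Section Extremal.

(** An internal description of the extremal graph: [T] is the edgeless part, [P] the joined clique
    and [Q] the set of extra neighbours of [v0]. Being stated for any graph, it can be verified for
    [G] without constructing an isomorphism. *)
Record extremal_structure (H : sgraph) (c e b : nat) (T P Q : {set H}) (v0 : H) : Prop := {
  ext_v0 : v0 \in T;
  ext_cardT : #|T| = b.+1;
  ext_cardP : #|P| = c;
  ext_cardQ : #|Q| = e;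
  ext_PT : [disjoint P & T];
  ext_QT : [disjoint Q & T];
  ext_PQ : [disjoint P & Q];
  ext_clique : forall x y, x \notin T -> y \notin T -> adj x y = (x != y);
  ext_indep : forall x y, x \in T -> y \in T -> adj x y = false;
  ext_cross : forall x y, x \in T -> y \notin T ->
    adj x y = (y \in P) || (x == v0) && (y \in Q) }.

(** Each element goes to the element of the same rank in the corresponding fibre. *)
Lemma fibre_bijection (A B : finType) (f : A -> nat) (g : B -> nat) :
  #|A| = #|B| -> (forall i, #|[pred x | f x == i]| = #|[pred y | g y == i]|) ->
  exists2 h : A -> B, bijective h & forall x, g (h x) = f x.
Proof.
move=> cAB fib.
have [y0 _|B0] := pickP (@predT B); last first.
  have B_F (y : B) : False by have := B0 y.
  have A_F (x : A) : False.
    by have := max_card (pred1 x); rewrite card1 cAB eq_card0 // => y; case: (B_F y).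
  exists (fun x => False_rect B (A_F x)) => [|x]; last by case: (A_F x).
  by exists (fun y => False_rect A (B_F y)) => [x|y]; [case: (A_F x) | case: (B_F y)].
pose h x := nth y0 (enum [pred y | g y == f x]) (index x (enum [pred z | f z == f x])).
have idx x : (index x (enum [pred z | f z == f x]) < size (enum [pred y | g y == f x]))%N.
  by rewrite -cardE -fib cardE index_mem mem_enum inE.
have gh x : g (h x) = f x.
  by have := mem_nth y0 (idx x); rewrite mem_enum inE => /eqP.
exists h => //; apply: inj_card_bij; last by rewrite cAB.
move=> x x' hh; have fx : f x = f x' by rewrite -gh hh gh.
move: (idx x') hh; rewrite /h -fx => idx' /eqP; rewrite nth_uniq ?enum_uniq ?idx //.
move/eqP => ii; have xs : x \in enum [pred z | f z == f x] by rewrite mem_enum inE.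
have x's : x' \in enum [pred z | f z == f x] by rewrite mem_enum inE fx.
by rewrite -(nth_index x xs) ii nth_index.
Qed.

Lemma extremal_structure_iso (G H : sgraph) (c e b : nat)
    (T P Q : {set G}) (v : G) (T' P' Q' : {set H}) (v' : H) :
  #|G| = #|H| -> extremal_structure c e b T P Q v ->
  extremal_structure c e b T' P' Q' v' -> graph_iso G H.
Proof.
move=> cGH sG sH.
(* Classes: 0 is [v], 1 the rest of [T], 2 is [P], 3 is [Q], 4 all others. The class sizes are
   determined by the parameters, and adjacency of distinct vertices depends only on their classes,
   through [m]. *)
pose cls (K : sgraph) (T P Q : {set K}) v x : nat :=
  (if x \in T then nat_of_bool (x != v) else if x \in P then 2 else if x \in Q then 3 else 4)%N.
pose m (i j : nat) : bool :=
  (if i < 2 then (2 <= j) && ((j == 2) || (i == 0) && (j == 3))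
   else (2 <= j) || (i == 2) || (j == 0) && (i == 3))%N.
have adjE (K : sgraph) (S U W : {set K}) w : extremal_structure c e b S U W w ->
    forall x y, adj x y = (x != y) && m (cls K S U W w x) (cls K S U W w y).
  move=> sK x y; rewrite /cls.
  case: (boolP (x \in S)) => xS; case: (boolP (y \in S)) => yS.
  - by rewrite (ext_indep sK) //; case: (x == w); case: (y == w); rewrite andbF.
  - have -> : x != y by apply/eqP => xy; rewrite -xy xS in yS.
    rewrite (ext_cross sK) //; case: (x == w); case: (y \in U); case: (y \in W) => //=.
  - have -> : x != y by apply/eqP => xy; rewrite xy yS in xS.
    rewrite adj_sym (ext_cross sK) //; case: (y == w); case: (x \in U); case: (x \in W) => //=.
  - rewrite (ext_clique sK) //.
    by case: (x \in U); case: (x \in W); case: (y \in U); case: (y \in W); rewrite andbT.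
have clsE (K : sgraph) (S U W : {set K}) w : extremal_structure c e b S U W w ->
    forall i, #|[pred x | cls K S U W w x == i]| =
      nth 0%N [:: 1%N; b; c; e; (#|K| - (b.+1 + c + e))%N] i.
  move=> sK.
  have SU := ext_PT sK; have SW := ext_QT sK; have UW := ext_PQ sK.
  have dSU : forall x, x \in U -> x \in S = false.
    by move=> x; exact: (disjointFr SU).
  have dSW : forall x, x \in W -> x \in S = false.
    by move=> x; exact: (disjointFr SW).
  have dUW : forall x, x \in W -> x \in U = false.
    by move=> x; exact: (disjointFl UW).
  case=> [|[|[|[|[|i]]]]] /=.
  - rewrite -(card1 w); apply: eq_card => x; rewrite !inE /cls.
    case: (boolP (x \in S)) => xS; first by case: (x == w).
    case: (eqVneq x w) => [xw|_]; first by rewrite xw (ext_v0 sK) in xS.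
    by case: ifP => // _; case: ifP.
  - have -> : b = #|S :\ w|.
      by have := cardsD1 w S; rewrite (ext_v0 sK) (ext_cardT sK) => -[].
    apply: eq_card => x; rewrite !inE /cls.
    case: (boolP (x \in S)) => xS; first by rewrite andbT; case: (x == w).
    by rewrite andbF; case: ifP => // _; case: ifP.
  - rewrite -(ext_cardP sK); apply: eq_card => x; rewrite !inE /cls.
    case: (boolP (x \in U)) => [/dSU->//|_].
    by case: ifP => _; [case: (x == w) | case: ifP].
  - rewrite -(ext_cardQ sK); apply: eq_card => x; rewrite !inE /cls.
    case: (boolP (x \in W)) => [xW|_]; first by rewrite dSW // dUW.
    by case: ifP => _; [case: (x == w) | case: ifP].
  - have -> : (b.+1 + c + e)%N = #|S :|: U :|: W|.
      rewrite !cardsU (ext_cardT sK) (ext_cardP sK) (ext_cardQ sK).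
      have -> : S :&: U = finset.set0.
        by apply/setP => x; rewrite !inE; case: (boolP (x \in U)) => [/dSU->//|]; rewrite andbF.
      have -> : (S :|: U) :&: W = finset.set0.
        apply/setP => x; rewrite !inE; case: (boolP (x \in W)) => [xW|]; rewrite ?andbF //.
        by rewrite dSW // dUW.
      by rewrite cards0 !subn0.
    rewrite -(cardsC (S :|: U :|: W)) addKn; apply: eq_card => x; rewrite !inE /cls.
    by case: ifP => _; [case: (x == w) | case: ifP => //= _; case: ifP].
  - rewrite nth_nil eq_card0 // => x; rewrite !inE /cls.
    by case: ifP => _; [case: (x == w) | case: ifP => //= _; case: ifP].
have fib i : #|[pred x | cls G T P Q v x == i]| = #|[pred y | cls H T' P' Q' v' y == i]|.
  by rewrite (clsE _ _ _ _ _ sG) (clsE _ _ _ _ _ sH) cGH.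
have [f fbij fcls] := fibre_bijection cGH fib.
exists f => // x y; rewrite (adjE _ _ _ _ _ sH) (adjE _ _ _ _ _ sG) !fcls.
by rewrite (bij_eq fbij).
Qed.

Lemma extremal_graph_structure (n a b k : nat) : (0 < a)%N -> (a + k + (a - 1) + b.+1 <= n)%N ->
  let H := extremal_graph n a b k in
  #|H| = n /\ exists (T P Q : {set H}) (v0 : H), extremal_structure (a + k) (a - 1) b T P Q v0.
Proof.
move=> a0 hn H.
have cH : #|H| = n by rewrite !card_sum !card_ord; lia.
split=> //.
pose T : {set H} := [set x : H | if x is inr (inr _) then true else false].
pose P : {set H} := [set x : H | if x is inl _ then true else false].
pose Q : {set H} := [set x : H | if x is inr (inl j) then (j < a - 1)%N else false].
pose v0 : H := inr (inr ord0).
exists T, P, Q, v0; split.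
- by rewrite inE.
- pose f (i : 'I_b.+1) : H := inr (inr i).
  have -> : T = f @: [set: 'I_b.+1].
    apply/setP => -[i|[j|i]]; rewrite !inE; apply/esym; try by apply/imsetP => -[].
    by apply/imsetP; exists i.
  by rewrite card_imset ?cardsT ?card_ord // => i j [].
- pose f (i : 'I_(a + k)) : H := inl i.
  have -> : P = f @: [set: 'I_(a + k)].
    apply/setP => -[i|j]; rewrite !inE; apply/esym; try by apply/imsetP => -[].
    by apply/imsetP; exists i.
  by rewrite card_imset ?cardsT ?card_ord // => i j [].
(* The size hypothesis ensures that the second clique has room for all [a - 1] extra neighbours. *)
- have aN : (a - 1 <= n - (a + b + k + 1))%N by lia.
  pose f (i : 'I_(a - 1)) : H := inr (inl (widen_ord aN i)).
  have -> : Q = f @: [set: 'I_(a - 1)].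
    apply/setP => -[i|[j|i]]; rewrite !inE; apply/esym; try by apply/imsetP => -[].
    case: (ltnP j (a - 1)) => ja.
      by apply/imsetP; exists (Ordinal ja) => //; congr (inr (inl _)); apply: val_inj.
    by apply/imsetP => -[i _ [ji]]; move: ja; rewrite ji /= leqNgt ltn_ord.
  by rewrite card_imset ?cardsT ?card_ord // => i j [/val_inj].
- by apply/pred0P => -[i|[j|i]]; rewrite /= !inE.
- by apply/pred0P => -[i|[j|i]]; rewrite /= !inE ?andbF.
- by apply/pred0P => -[i|[j|i]]; rewrite /= !inE.
- move=> [i|[j|i]] [i'|[j'|i']]; rewrite !inE //= => _ _;
    by rewrite /add_adj /= ?andbF ?orbF.
- move=> [i|[j|i]] [i'|[j'|i']]; rewrite !inE //= => _ _;
    by rewrite /add_adj /= ?andbF ?orbF.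
- move=> [i|[j|i]] [i'|[j'|i']]; rewrite !inE //= => _ _.
  by rewrite /add_adj /= orbF.
Qed.

End Extremal.

(** * Test vectors on the extremal graph *)

Section Subinvariant.
Variables (R : realType) (H : sgraph) (c e b : nat) (T P Q : {set H}) (v0 : H).
Hypothesis sH : extremal_structure c e b T P Q v0.

(* [y] takes the values [p] at [v0] and [q] on the rest of [T]; on the clique it
   solves [(l + 1) y u = 1 + sum of y over the neighbours of u in T]. *)
Lemma extremal_subinvariant (l p q : R) : 0 <= l -> 0 <= p -> 0 <= q ->
  (0 < #|~: T|)%N ->
  l * (l + 1) * p <= (c + e)%:R * (1 + p) + (c * b)%:R * q ->
  l * (l + 1) * q <= c%:R * (1 + p + b%:R * q) ->
  l + 1 <= #|~: T|%:R + (c + e)%:R * p + (c * b)%:R * q ->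
  [/\ l <= spectral_radius R H,
    0 < q -> (0 < b)%N -> l * (l + 1) * q < c%:R * (1 + p + b%:R * q) -> l < spectral_radius R H
    & l + 1 < #|~: T|%:R + (c + e)%:R * p + (c * b)%:R * q -> l < spectral_radius R H].
Proof.
move=> l0 p0 q0 N0 h1 h2 h3; rewrite !natrM !natrD in h1 h2 h3 *.
have b0 : 0 <= b%:R :> R by rewrite ler0n.
have bq0 : 0 <= b%:R * q by exact: mulr_ge0.
have l1 : 0 < l + 1 by lra.
have H0 : (0 < #|H|)%N by apply/card_gt0P; exists v0.
have PT := ext_PT sH; have QT := ext_QT sH; have PQ := ext_PQ sH.
have PnT x : x \in P -> x \in T = false by exact: (disjointFr PT).
have QnT x : x \in Q -> x \in T = false by exact: (disjointFr QT).
have QnP x : x \in Q -> x \in P = false by exact: (disjointFl PQ).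
(* For [x] outside [T], [tau x] is the weight that [x] sees in [T]. *)
pose tau (x : H) : R := if x \in P then p + b%:R * q else if x \in Q then p else 0.
have tau0 x : 0 <= tau x.
  by rewrite /tau; case: ifP => _; [exact: addr_ge0 | case: ifP].
pose y x : R := if x \in T then if x == v0 then p else q else (1 + tau x) / (l + 1).
have yC x : x \notin T -> y x = (1 + tau x) / (l + 1) by rewrite /y => /negbTE->.
have yv0 : y v0 = p by rewrite /y (ext_v0 sH) eqxx.
have yT x : x \in T -> x != v0 -> y x = q by rewrite /y => -> /negbTE->.
have y0 x : 0 <= y x.
  rewrite /y; case: ifP => _; first by case: ifP.
  by apply: divr_ge0; [apply: addr_ge0 | exact: ltW].
have sumP : \sum_(v in P) y v = c%:R * ((1 + p + b%:R * q) / (l + 1)).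
  rewrite (eq_bigr (fun=> (1 + p + b%:R * q) / (l + 1))) => [|x xP].
    by rewrite sumr_const (ext_cardP sH) [RHS]mulr_natl.
  by rewrite yC ?PnT // /tau xP addrA.
have sumQ : \sum_(v in Q) y v = e%:R * ((1 + p) / (l + 1)).
  rewrite (eq_bigr (fun=> (1 + p) / (l + 1))) => [|x xQ].
    by rewrite sumr_const (ext_cardQ sH) [RHS]mulr_natl.
  by rewrite yC ?QnT // /tau QnP // xQ.
have sumT : \sum_(v in T | v != v0) y v = b%:R * q.
  rewrite (eq_bigr (fun=> q)) => [|x /andP[]]; last exact: yT.
  rewrite sumr_const [RHS]mulr_natl; congr (_ *+ _).
  have := cardsD1 v0 T; rewrite (ext_v0 sH) (ext_cardT sH) => -[->].
  by apply: eq_card => x; rewrite !inE andbC.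
have tauE x : x \notin T -> \sum_(v in T | adj x v) y v = tau x.
  move=> xT; rewrite (bigID (pred1 v0)) /= /tau.
  have cr v : v \in T -> adj x v = (x \in P) || (v == v0) && (x \in Q).
    by move=> vT; rewrite adj_sym (ext_cross sH).
  case: (boolP (x \in P)) => xP.
    congr (_ + _).
      rewrite (big_pred1 v0) // => v; rewrite /= [LHS]andbC.
      by case: eqP => //= ->; rewrite (ext_v0 sH) cr ?(ext_v0 sH) // xP.
    rewrite -sumT; apply: eq_bigl => v; case: (boolP (v \in T)) => //= vT.
    by rewrite cr // xP.
  rewrite [X in _ + X]big1 ?addr0; last first.
    by move=> v /andP[/andP[vT]]; rewrite cr // (negbTE xP) => /andP[->].
  case: (boolP (x \in Q)) => xQ.
    rewrite (big_pred1 v0) // => v; rewrite /= [LHS]andbC.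
    by case: eqP => //= ->; rewrite (ext_v0 sH) cr ?(ext_v0 sH) // xQ eqxx orbT.
  rewrite big_pred0 // => v; case: (boolP (v \in T)) => //= vT.
  by rewrite cr // (negbTE xP) (negbTE xQ) andbF.
have sumC : \sum_(v | v \notin T) y v =
    (#|~: T|%:R + (c%:R * (p + b%:R * q) + e%:R * p)) / (l + 1).
  rewrite (eq_bigr (fun v => (1 + tau v) / (l + 1))) => [|v]; last exact: yC.
  rewrite -mulr_suml big_split /=; congr ((_ + _) / _).
    by rewrite -sum1_card natr_sum; apply: eq_bigl => v; rewrite inE.
  rewrite (bigID (mem P)) /=; congr (_ + _).
    rewrite (eq_big (mem P) (fun=> p + b%:R * q)) => [|v|v /andP[_ vP]].
    - by rewrite sumr_const (ext_cardP sH) [RHS]mulr_natl.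
    - by rewrite /= andbC; case: (boolP (v \in P)) => //= /PnT->.
    - by rewrite /tau vP.
  rewrite (bigID (mem Q)) /= [X in _ + X]big1 ?addr0; last first.
    by move=> v /andP[/andP[_ /negbTE vP] /negbTE vQ]; rewrite /tau vP vQ.
  rewrite (eq_big (mem Q) (fun=> p)) => [|v|v /andP[/andP[_ /negbTE vP] vQ]].
  - by rewrite sumr_const (ext_cardQ sH) [RHS]mulr_natl.
  - by rewrite /= andbC; case: (boolP (v \in Q)) => //= vQ; rewrite QnT // QnP.
  - by rewrite /tau vP vQ.
(* The surplus over [l * y x] is the same for all clique vertices, so the single inequality [h3]
   covers all of them. *)
have nbC x : x \notin T -> \sum_(v | adj x v) y v =
    l * y x + ((#|~: T|%:R + (c%:R * (p + b%:R * q) + e%:R * p)) / (l + 1) - 1).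
  move=> xT; rewrite (bigID (mem T)) /=.
  rewrite (eq_bigl (fun v => (v \in T) && adj x v)) => [|v]; last by rewrite andbC.
  rewrite tauE // (eq_bigl (fun v => (v \notin T) && (v != x))) => [|v]; last first.
    by rewrite andbC; case: (boolP (v \in T)) => //= vT; rewrite (ext_clique sH) // eq_sym.
  have := sumC; rewrite (bigD1 x) //= => <-.
  have : y x * (l + 1) = 1 + tau x by rewrite yC // divfK // gt_eqF.
  by move=> h; lra.
have nbv0 : \sum_(v | adj v0 v) y v =
    c%:R * ((1 + p + b%:R * q) / (l + 1)) + e%:R * ((1 + p) / (l + 1)).
  rewrite (bigID (mem P)) /= -sumP -sumQ; congr (_ + _); apply: eq_bigl => v.
    rewrite andbC; case: (boolP (v \in P)) => //= vP.
    by rewrite (ext_cross sH) ?(ext_v0 sH) ?PnT // vP.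
  case: (boolP (v \in T)) => vT.
    rewrite (ext_indep sH) ?(ext_v0 sH) //=.
    by apply/esym/negP => /QnT; rewrite vT.
  rewrite (ext_cross sH) ?(ext_v0 sH) // eqxx /=.
  by case: (boolP (v \in Q)) => [/QnP->//|_]; case: (v \in P).
have nbT x : x \in T -> x != v0 ->
    \sum_(v | adj x v) y v = c%:R * ((1 + p + b%:R * q) / (l + 1)).
  move=> xT xv0; rewrite -sumP; apply: eq_bigl => v.
  case: (boolP (v \in T)) => vT.
    by rewrite (ext_indep sH) //; apply/esym/negP => /PnT; rewrite vT.
  by rewrite (ext_cross sH) // (negbTE xv0) orbF.
have h2' : l * q <= c%:R * ((1 + p + b%:R * q) / (l + 1)).
  by rewrite mulrA ler_pdivlMr // mulrAC.
have h1' : l * p <= c%:R * ((1 + p + b%:R * q) / (l + 1)) + e%:R * ((1 + p) / (l + 1)).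
  by rewrite !mulrA -mulrDl ler_pdivlMr // mulrAC; lra.
have h3' : 1 <= (#|~: T|%:R + (c%:R * (p + b%:R * q) + e%:R * p)) / (l + 1).
  by rewrite ler_pdivlMr // mul1r; lra.
have sub x : l * y x <= \sum_(v | adj x v) y v.
  case: (boolP (x \in T)) => xT; last by rewrite nbC //; lra.
  case: (eqVneq x v0) => [->|xv0]; first by rewrite nbv0 yv0.
  by rewrite nbT // yT.
have [w wT] : exists w, w \notin T.
  by move: N0 => /card_gt0P[w]; rewrite inE => wT; exists w.
have yw : 0 < y w by rewrite yC // divr_gt0 // ltr_wpDr.
split.
- by apply: subinvariant_le sub => //; exists w.
- move=> qp bp h; apply: (subinvariant_lt H0 y0 sub).
  have : (0 < #|T :\ v0|)%N.
    have := cardsD1 v0 T; rewrite (ext_v0 sH) (ext_cardT sH) => -[bE].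
    by move: bp; rewrite bE.
  move=> /card_gt0P[x]; rewrite !inE => /andP[xv0 xT].
  exists x; first by rewrite yT.
  by rewrite nbT // yT // mulrA ltr_pdivlMr // mulrAC.
- move=> h; apply: (subinvariant_lt H0 y0 sub); exists w => //.
  rewrite nbC // ltrDl subr_gt0 ltr_pdivlMr // mul1r; lra.
Qed.

(** The test vector with [p = q = 0] is constant on the clique and zero on [T]. *)
Lemma extremal_spectral_radius_ge : (0 < #|~: T|)%N ->
  #|~: T|%:R - 1 <= spectral_radius R H.
Proof.
move=> N0; have N1 : 1 <= #|~: T|%:R :> R by rewrite ler1n.
have c0 : 0 <= c%:R :> R by rewrite ler0n.
have ce0 : 0 <= (c + e)%:R :> R by rewrite ler0n.
by case: (@extremal_subinvariant (#|~: T|%:R - 1) 0 0) => //; lra.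
Qed.
End Subinvariant.

(** * Degree sums and the spectral radius *)

Section DegreeBounds.
Variables (R : realType) (G : sgraph).

(** The degrees in [T] count twice: once for [T] itself and once as a bound on the edges entering
    [T] from outside. *)
Lemma sum_degree_le (T : {set G}) :
  (\sum_(v : G) degree v <= (#|G| - #|T|) * (#|G| - #|T| - 1) + 2 * \sum_(v in T) degree v)%N.
Proof.
have cC : #|~: T| = (#|G| - #|T|)%N by rewrite -(cardsC T) addKn.
have cross : (\sum_(v | v \notin T) #|[set w | adj v w & w \in T]| <= \sum_(v in T) degree v)%N.
  under eq_bigr do rewrite -sum1_card.
  rewrite (exchange_big_dep (mem T)) /=; last by move=> v w _; rewrite inE => /andP[].
  apply: leq_sum => w wT; rewrite sum1_card; apply: subset_leq_card.
  by apply/fintype.subsetP => v; rewrite !inE unfold_in inE => /and3P[_ vw _]; rewrite adj_sym.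
rewrite (bigID (mem T)) /= addnC mul2n -addnn addnA leq_add2r.
apply: leq_trans (_ : (\sum_(v | v \notin T)
    (#|G| - #|T| - 1 + #|[set w | adj v w & w \in T]|) <= _)%N).
  apply: leq_sum => v vT; rewrite /degree.
  apply: leq_trans (_ : (#|(~: T) :\ v| + #|[set w | adj v w & w \in T]| <= _)%N).
    apply: leq_trans (leq_card_setU _ _); apply: subset_leq_card.
    apply/fintype.subsetP => w; rewrite !inE => vw; rewrite vw.
    case: (w \in T) => /=; rewrite ?orbT // orbF andbT.
    by apply: contraTneq vw => ->; rewrite adj_irr.
  by rewrite leq_add2r; have := cardsD1 v (~: T); rewrite inE vT cC => ->; rewrite addKn.
rewrite big_split /= leq_add // sum_nat_const leq_mul2r; apply/orP; right.
by rewrite -cC; apply: subset_leq_card; apply/fintype.subsetP => v; rewrite inE.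
Qed.

(** Two steps of the eigenvector equation at a largest entry, at [u], bound the square by the degree
    sum over the neighbours of [u]. The remaining degrees add up to at least [#|G| - 1]: [degree u]
    from [u], and at least 1 from each other non-neighbour. *)
Lemma spectral_radius_sq_le : (0 < #|G|)%N -> (forall v : G, 0 < degree v)%N ->
  spectral_radius R G ^+ 2 + (#|G| - 1)%:R <= (\sum_(v : G) degree v)%:R.
Proof.
move=> G0 deg_gt0; have [x [x0 [g xg] xE _]] := perron R G0.
pose u := [arg max_(u > g) x u]%O.
have xu v : x v <= x u by rewrite /u; case: arg_maxP => // i _; apply.
have xu0 : 0 < x u := lt_le_trans xg (xu g).
set l := spectral_radius R G in xE *.
have lx v : l * x v <= (degree v)%:R * x u.
  rewrite xE mulr_natl -sumr_const; apply: le_trans (_ : \sum_(w | adj v w) x u <= _).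
    by apply: ler_sum.
  by rewrite le_eqVlt; apply/orP; left; apply/eqP; apply: eq_bigl => w; rewrite inE.
have l2 : l ^+ 2 <= (\sum_(v | adj u v) degree v)%:R.
  rewrite -(ler_pM2r xu0) expr2 -mulrA xE big_distrr natr_sum mulr_suml /=.
  by apply: ler_sum => v _.
apply: le_trans (lerD l2 (lexx _)) _; rewrite -natrD ler_nat.
rewrite [X in (_ <= X)%N](bigID (adj u)) /= leq_add2l.
rewrite (bigD1 u) ?adj_irr //=.
apply: leq_trans (_ : (degree u + \sum_(v | ~~ adj u v && (v != u)) 1 <= _)%N).
  rewrite sum1_card /degree -leq_subLR.
  have := cardsC (u |: [set w | adj u w]); rewrite cardsU1 inE adj_irr /= => <-.
  set s := #|[set w | adj u w]|; set r := #|~: _|; have -> : (1 + s + r - 1 - s = r)%N by lia.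
  by apply: subset_leq_card; apply/fintype.subsetP => v; rewrite !inE unfold_in negb_or andbC.
by rewrite leq_add2l; apply: leq_sum => v _; exact: deg_gt0.
Qed.
End DegreeBounds.

(** * Numerical consequences of the lower bound on [n] *)

(** The term [2 * (b * s + 1)] is moved to the right to avoid truncated subtraction. The net
    coefficient [2 * (t - b)] of [s] is positive, so upper bounds on [s] are needed: [s < t] serves
    when [2 * t <= n], and [s + k <= n - t] otherwise. *)
Lemma large_independent_part_arith (a b k n t s : nat) : (0 < a)%N -> (a <= b)%N ->
  (2 * (b + a + k + 2) * (b + k + 2) <= n)%N -> (s + k + t <= n)%N ->
  (b * s < a * t)%N -> (b + 2 <= t)%N ->
  ((n - t) * (n - t - 1) + 2 * ((s + k + a) * t) < (n - (b + 2)) ^ 2 + (n - 1) + 2 * (b * s + 1))%N.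
Proof.
move=> a0 ab hn hs hst ht.
have st : (s < t)%N by rewrite -(ltn_pmul2l (leq_trans a0 ab)) (leq_trans hst) // leq_mul2r ab orbT.
have [m nE] : exists m, n = (t + m)%N by exists (n - t)%N; lia.
have [j tE] : exists j, t = (b + 2 + j)%N by exists (t - (b + 2))%N; lia.
have BE : exists2 B, B = (b + k + 2)%N & (2 * (B * B) + 2 * B <= n)%N.
  by exists (b + k + 2)%N => //; nia.
have n3 : (6 * (b + a + k + 2) <= n)%N.
  have : (2 * (b + a + k + 2) * 3 <= 2 * (b + a + k + 2) * (b + k + 2))%N.
    by rewrite leq_mul2l; apply/orP; right; lia.
  by move/leq_trans/(_ hn); lia.
have -> : (n - t = m)%N by lia.
have -> : (n - (b + 2) = j + m)%N by lia.
have mm : (m * (m - 1) + m = m * m)%N by case: (m) => // m'; rewrite subn1 /=; lia.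
rewrite expnS expn1.
suff : (m * m + 2 * ((s + k + a) * t) < (j + m) * (j + m) + (n - 1) + 2 * (b * s + 1) + m)%N by lia.
case: (leqP (2 * t) n) => tn.
  have [i nEi] : exists i, n = (2 * t + i)%N by exists (n - 2 * t)%N; lia.
  have mE : m = (t + i)%N by lia.
  have h1 : (t * s + t * a <= t * t + b * s)%N.
    have [d tbd] : exists d, t = (b + d)%N by exists (t - b)%N; lia.
    have : (d * s.+1 <= d * t)%N by rewrite leq_mul2l st orbT.
    have : (t * a <= t * b)%N by rewrite leq_mul2l ab orbT.
    by rewrite tbd; lia.
  have [B BE1 Bn] := BE; have B3 : (3 <= B)%N by lia.
  (* For [t < B] the slack [i] alone suffices. For [t = B + r], the product [j.+1 * i] dominates
     while [r <= 3 * B], and [j * j] beyond that. *)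
  have h2 : (2 * (t * B) < 2 * (j.+1 * i) + j * j + 3 * t + 1)%N.
    case: (leqP B t) => Bt; last first.
      have : (B * t <= B * B)%N by rewrite leq_mul2l (ltnW Bt) orbT.
      have : (2 * (B * B) <= i)%N by lia.
      have : (i <= j.+1 * i)%N by rewrite leq_pmull.
      have : (0 < B * B)%N by rewrite muln_gt0; lia.
      lia.
    have [r tr] : exists r, t = (B + r)%N by exists (t - B)%N; lia.
    have rj : (r <= j)%N by lia.
    have rrj : (r * r <= j * j)%N by exact: leq_mul.
    case: (leqP r (3 * B)) => r3.
      have : (r.+1 * i <= j.+1 * i)%N by rewrite leq_mul2r ltnS rj orbT.
      have : (r.+1 * (2 * (B * B)) <= r.+1 * (i + 2 * r))%N by rewrite leq_mul2l; lia.
      have : (r * r <= r * (3 * B))%N by rewrite leq_mul2l r3 orbT.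
      have : (r * (3 * B) <= r * (B * B))%N by rewrite leq_mul2l leq_mul2r B3 !orbT.
      have : (3 * B <= B * B)%N by rewrite leq_mul2r B3 orbT.
      have : (3 * r <= B * r)%N by rewrite leq_mul2r B3 orbT.
      by rewrite tr; lia.
    have : (3 * B * r <= r * r)%N by rewrite leq_mul2r (ltnW r3) orbT.
    have : (B * (3 * B) <= B * r)%N by rewrite leq_mul2l (ltnW r3) orbT.
    by rewrite tr; lia.
  by move: h1 h2; rewrite mE BE1 tE nEi; lia.
have [d tbd] : exists d, t = (b + d)%N by exists (t - b)%N; lia.
have h1 : (d * (s + k) <= d * m)%N by rewrite leq_mul2l; lia.
have h2 : (2 * m + 2 * (b * k) + 2 * (a * t) < j * j + t + 1)%N.
  have [r tr] : exists r, t = (3 * (b + a + k + 2) + r)%N.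
    by exists (t - 3 * (b + a + k + 2))%N; lia.
  have -> : j = (2 * b + 3 * a + 3 * k + 4 + r)%N by lia.
  suff : (2 * (b * k) + 2 * (a * t) + t <
    (2 * b + 3 * a + 3 * k + 4 + r) * (2 * b + 3 * a + 3 * k + 4 + r) + 1)%N by lia.
  have : (a * b <= b * b)%N by rewrite leq_mul2r ab orbT.
  rewrite tr; lia.
have dE : d = (2 + j)%N by lia.
by move: h1 h2; rewrite tE dE; lia.
Qed.

(** With [A] and [B] the two factors of the bound on [n], [D <= A * B] while
    [mu >= 2 * (A * B) ^+ 2]. In the last estimate the left-hand terms are at most a twelfth and a
    third of [e * mu ^+ 2]. *)
Lemma spectral_gap_arith (R : realType) (a b k n : nat) (l : R) :
  (0 < a)%N -> (a <= b)%N -> (2 * (b + a + k + 2) * (b + k + 2) <= n)%N ->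
  (n - (b + 2))%:R <= l ->
  let c := (a + k)%:R : R in let e := (a - 1)%:R : R in
  let D := b.+1%:R * c + e in let mu := l * (l + 1) in
  [/\ 0 < l, 2 * D <= mu, 2 * (c + e) <= l &
    0 < e -> c * D ^+ 3 + e * (c + e) * D * mu < e * mu ^+ 2].
Proof.
move=> a0 ab hn hl c e D mu.
pose A : R := (b + a + k + 2)%:R; pose B : R := (b + k + 2)%:R.
have B3 : 3 <= B by rewrite /B ler_nat; lia.
have A4 : 4 <= A by rewrite /A ler_nat; lia.
have AB : B <= A by rewrite /A /B ler_nat; lia.
have c0 : 0 <= c by rewrite ler0n.
have e0 : 0 <= e by rewrite ler0n.
have cA : c <= A by rewrite ler_nat; lia.
have ceA : c + e <= 2 * A by rewrite -natrM -natrD ler_nat; lia.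
have DAB : D <= A * B.
  rewrite /D /c /e /A /B -!natrM -natrD ler_nat.
  have : ((b + 2) * (a + k) <= (b + a + k + 2) * (b + k + 2))%N.
    by rewrite mulnC leq_mul //; lia.
  lia.
have D0 : 0 <= D by rewrite addr_ge0 // mulr_ge0 // ler0n.
have lAB : 2 * A * B - B <= l.
  apply: le_trans hl; rewrite /A /B -!natrM lerBlDr -natrD ler_nat; lia.
have AB0 : 3 * A <= A * B by nra.
have l32 : (3 / 2) * (A * B) <= l by nra.
have mu2 : 2 * (A * B) ^+ 2 <= mu.
  rewrite /mu; have : ((3 / 2) * (A * B)) ^+ 2 <= l ^+ 2.
    by rewrite ler_pXn2r ?nnegrE //; nra.
  by nra.
have AB12 : 12 <= A * B by nra.
split; [nra | nra | nra |] => e_gt0.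
have e1 : 1 <= e by move: e_gt0; rewrite /e ltr0n ler1n.
have h1 : (c + e) * D * 3 <= mu.
  have : (c + e) * D <= (2 * A) * (A * B) by apply: ler_pM => //; lra.
  have : 0 <= A * (A * B) by rewrite !mulr_ge0 //; lra.
  have : (2 * A) * (A * B) * B <= mu by nra.
  by nra.
have h2 : c * D ^+ 3 * 12 <= mu ^+ 2.
  have : c * D ^+ 3 <= A * (A * B) ^+ 3.
    by apply: ler_pM => //; [exact: exprn_ge0 | rewrite ler_pXn2r ?nnegrE //; nra].
  have : (2 * (A * B) ^+ 2) ^+ 2 <= mu ^+ 2.
    by rewrite ler_pXn2r ?nnegrE //; nra.
  have -> : (2 * (A * B) ^+ 2) ^+ 2 = 4 * B * (A * (A * B) ^+ 3) by ring.
  have : 0 <= A * (A * B) ^+ 3 by rewrite mulr_ge0 ?exprn_ge0 //; nra.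
  by nra.
have mup : 0 < mu by nra.
have h3 : e * ((c + e) * D * 3) * mu <= e * mu * mu.
  by rewrite ler_pM2r // ler_wpM2l.
have : mu ^+ 2 <= e * mu ^+ 2 by rewrite ler_peMl // sqr_ge0.
have : 0 < mu ^+ 2 by rewrite exprn_gt0.
nra.
Qed.

(** * Perron vector inequalities relative to a vertex set [T] *)

Section SmallPart.
Variables (R : realType) (G : sgraph) (T : {set G}) (x : G -> R) (l : R).
Hypothesis xpos : forall u, 0 < x u.
Hypothesis eig : forall u, l * x u = \sum_(v | adj u v) x v.

Let sigma := \sum_(v | v \notin T) x v.
Let Z := \sum_(v in T) x v.
Let mu := l * (l + 1).
Let nbC v : {set G} := [set u | adj v u & u \notin T].

Lemma total_weight u : sigma + Z = x u + \sum_(v | v != u) x v.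
Proof. by rewrite /sigma /Z addrC -(bigID (mem T) predT) /= (bigD1 u). Qed.

(** The left side is the weight of the closed neighbourhood of [u]. *)
Lemma entry_le_total u : (l + 1) * x u <= sigma + Z.
Proof.
rewrite mulrDl mul1r (total_weight u) addrC lerD2l eig.
rewrite [X in _ <= X](bigID (adj u)) /= (eq_bigl (fun v => (v != u) && adj u v)) => [|v].
  by rewrite lerDl sumr_ge0 // => v _; exact: ltW.
by case: eqP => //= ->; rewrite adj_irr.
Qed.

Lemma entry_eq_total u : (l + 1) * x u = sigma + Z -> forall v : G, v != u -> adj u v.
Proof.
rewrite mulrDl mul1r (total_weight u) addrC => /addrI; rewrite eig.
rewrite [in RHS](bigID (adj u)) /= (eq_bigl (fun v => (v != u) && adj u v)) => [|v]; last first.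
  by case: eqP => //= ->; rewrite adj_irr.
set s1 := \sum_(v | _) x v; set s2 := \sum_(v | _) x v => hs v vu.
have h : s2 = 0 by lra.
apply: contraT => nuv.
have := xpos v; have : x v <= \sum_(w | (w != u) && ~~ adj u w) x w.
  rewrite (bigD1 v) /= ?vu // lerDl sumr_ge0 // => w _; exact: ltW.
by rewrite -/s2 h => /le_lt_trans h' /h'; rewrite ltxx.
Qed.

Lemma entry_two_step v : mu * x v = \sum_(u | adj v u) (l + 1) * x u.
Proof. by rewrite /mu mulrAC eig big_distrl /=; apply: eq_bigr => u _; rewrite mulrC. Qed.

Lemma sum_adj_const (v : G) (a : R) : \sum_(u | adj v u) a = (degree v)%:R * a.
Proof.
rewrite mulr_natl -sumr_const; apply: eq_bigl => u; by rewrite inE.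
Qed.

Lemma entry_le_degree (v : G) : mu * x v <= (degree v)%:R * (sigma + Z).
Proof.
rewrite entry_two_step -sum_adj_const; apply: ler_sum => u _; exact: entry_le_total.
Qed.

(** Equality must hold at each neighbour of [v]; by positivity the closed neighbourhood of that
    neighbour is then the whole graph. *)
Lemma entry_eq_degree (v : G) : mu * x v = (degree v)%:R * (sigma + Z) ->
  forall u w : G, adj v u -> w != u -> adj u w.
Proof.
rewrite entry_two_step -sum_adj_const => /eqP; rewrite eq_sym -subr_eq0 -sumrB.
rewrite psumr_eq0 => [/allP h u w vu|u _]; last by rewrite subr_ge0 entry_le_total.
apply: entry_eq_total; have := h u (mem_index_enum _); rewrite vu subr_eq0.
by move/eqP.
Qed.

Lemma clique_part_sum :
  l * sigma = \sum_(w | w \notin T) #|nbC w|%:R * x w + \sum_(w in T) #|nbC w|%:R * x w.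
Proof.
rewrite [RHS]addrC -(bigID (mem T) predT (fun w => #|nbC w|%:R * x w)) /=.
rewrite /sigma big_distrr /= (eq_bigr (fun u => \sum_(v | adj u v) x v)) => [|u _]; last exact: eig.
rewrite (exchange_big_dep predT) //=; apply: eq_bigr => w _.
rewrite sumr_const mulr_natl; congr (_ *+ _); apply: eq_card => u.
by rewrite !inE adj_sym andbC.
Qed.

Lemma card_nbC_clique (w : G) : w \notin T -> (#|nbC w| <= #|~: T| - 1)%N.
Proof.
move=> wT; have -> : (#|~: T| - 1 = #|~: T :\ w|)%N.
  by have := cardsD1 w (~: T); rewrite inE wT => ->; rewrite addKn.
apply: subset_leq_card; apply/fintype.subsetP => u; rewrite !inE => /andP[wu ->].
by rewrite andbT; apply: contraTneq wu => ->; rewrite adj_irr.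
Qed.

Lemma card_nbC_le (w : G) : (#|nbC w| <= degree w)%N.
Proof. by apply: subset_leq_card; apply/fintype.subsetP => u; rewrite !inE => /andP[]. Qed.

Lemma clique_card (w : G) : w \notin T -> (0 < #|~: T|)%N.
Proof. by move=> wT; apply/card_gt0P; exists w; rewrite inE. Qed.

(** In [l * sigma] each [x w] is counted once per neighbour of [w] outside [T]. Equality therefore
    means a clique outside [T] and no edges inside it. *)
Lemma clique_part_le :
  (l + 1) * sigma <= #|~: T|%:R * sigma + \sum_(w in T) (degree w)%:R * x w.
Proof.
rewrite mulrDl mul1r clique_part_sum addrAC lerD //; last first.
  by apply: ler_sum => w _; rewrite ler_pM2r // ler_nat card_nbC_le.
rewrite /sigma -big_split big_distrr /=; apply: ler_sum => w wT.
rewrite -[X in _ + X]mul1r -mulrDl ler_pM2r // natr1 ler_nat.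
by have := card_nbC_clique wT; have := clique_card wT; lia.
Qed.

Lemma clique_part_eq :
  (l + 1) * sigma = #|~: T|%:R * sigma + \sum_(w in T) (degree w)%:R * x w ->
  (forall u v : G, u \notin T -> v \notin T -> adj u v = (u != v)) /\
  (forall u v : G, u \in T -> v \in T -> adj u v = false).
Proof.
rewrite mulrDl mul1r clique_part_sum => h.
have h1 : \sum_(w | w \notin T) (#|~: T|%:R - #|nbC w|%:R - 1) * x w
    + \sum_(w in T) ((degree w)%:R - #|nbC w|%:R) * x w = 0.
  rewrite (eq_bigr (fun w => #|~: T|%:R * x w - #|nbC w|%:R * x w - x w)) => [|w _]; last by ring.
  rewrite [X in _ + X](eq_bigr (fun w =>
    (degree w)%:R * x w - #|nbC w|%:R * x w)) => [|w _]; last by ring.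
  rewrite !sumrB -big_distrr /= -/sigma; move: h; rewrite /sigma; lra.
have g1 w : w \notin T -> 0 <= (#|~: T|%:R - #|nbC w|%:R - 1) * x w.
  move=> wT; rewrite pmulr_lge0 // -addrA -opprD subr_ge0 natr1 ler_nat.
  by have := card_nbC_clique wT; have := clique_card wT; lia.
have g2 w : w \in T -> 0 <= ((degree w)%:R - #|nbC w|%:R) * x w.
  by move=> wT; rewrite pmulr_lge0 // subr_ge0 ler_nat card_nbC_le.
move/eqP: h1; rewrite paddr_eq0; [|exact: sumr_ge0|exact: sumr_ge0].
rewrite !psumr_eq0 // => /andP[/allP e1 /allP e2]; split.
  move=> u v uT vT; have := e1 u (mem_index_enum _); rewrite uT /=.
  rewrite mulf_eq0 (gt_eqF (xpos u)) orbF -addrA -opprD subr_eq0 natr1 eqr_nat => /eqP cu.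
  have sub : nbC u \subset ~: T :\ u.
    apply/fintype.subsetP => w; rewrite !inE => /andP[uw ->].
    by rewrite andbT; apply: contraTneq uw => ->; rewrite adj_irr.
  have cc : #|nbC u| = #|~: T :\ u|.
    by have := cardsD1 u (~: T); rewrite inE uT; lia.
  have /setP/(_ v) : nbC u = ~: T :\ u by apply/eqP; rewrite eqEcard sub cc leqnn.
  by rewrite !inE vT !andbT eq_sym.
move=> u v uT vT; have := e2 u (mem_index_enum _); rewrite uT /=.
rewrite mulf_eq0 (gt_eqF (xpos u)) orbF subr_eq0 eqr_nat => /eqP cu.
have sub : nbC u \subset [set w | adj u w].
  by apply/fintype.subsetP => w; rewrite !inE => /andP[].
have /setP/(_ v) : nbC u = [set w | adj u w] by apply/eqP; rewrite eqEcard sub -cu leqnn.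
by rewrite !inE vT andbF.
Qed.

Lemma entry_le_clique (u : G) : (u \in T -> (l + 1) * x u <= sigma) ->
  (l + 1) * x u <= sigma + \sum_(w in T | adj u w) x w.
Proof.
move=> hT; case: (boolP (u \in T)) => [/hT h|uT].
  by apply: le_trans h _; rewrite lerDl sumr_ge0 // => w _; exact: ltW.
rewrite mulrDl mul1r eig (bigID (mem T)) /=.
rewrite (eq_bigl (fun w => (w \in T) && adj u w)) => [|w]; last by rewrite andbC.
suff : x u + \sum_(v | adj u v && (v \notin T)) x v <= sigma by move=> h; lra.
rewrite /sigma [X in _ <= X](bigD1 u) //= lerD2l [X in _ <= X](bigID (adj u)) /=.
rewrite [X in _ <= X + _](eq_bigl (fun v => adj u v && (v \notin T))) => [|v].
  by rewrite lerDl sumr_ge0 // => v _; exact: ltW.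
by case: eqP => [->|]; rewrite ?adj_irr ?andbF // andbT andbC.
Qed.

(** Over walks of length two from [v], [x v] is counted [degree v] times and any other [x w] with
    [w] in [T] once per common neighbour, hence at most [degree w] times. The first premise handles
    neighbours of [v] lying in [T], which is not yet known to be independent. *)
Lemma entry_le_codegree (v : G) (d : R) :
  (forall u, u \in T -> (l + 1) * x u <= sigma) ->
  (forall w, w \in T -> w != v -> (degree w)%:R <= d) -> v \in T ->
  mu * x v <= (degree v)%:R * (sigma + x v) + d * \sum_(w in T | w != v) x w.
Proof.
move=> hT hd vT; rewrite entry_two_step.
apply: le_trans (_ : \sum_(u | adj v u) (sigma + \sum_(w in T | adj u w) x w) <= _).
  by apply: ler_sum => u _; apply: entry_le_clique => uT; exact: hT.
rewrite big_split /= sum_adj_const mulrDr -addrA lerD2l.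
rewrite (exchange_big_dep (mem T)) /=; last by move=> u w _ /andP[].
have inner v' w : (forall u, adj u w -> adj v u -> adj v' u) ->
    \sum_(u | adj v u && ((w \in T) && adj u w)) x w <= (degree v')%:R * x w.
  move=> sub; rewrite -sum_adj_const big_mkcond [X in _ <= X]big_mkcond /=.
  apply: ler_sum => u _; case: (boolP (adj v u)) => vu /=; last by case: ifP => // _; exact: ltW.
  case: (boolP (adj u w)) => uw; last by rewrite andbF; case: ifP => // _; exact: ltW.
  by rewrite sub //; case: ifP => // _; exact: ltW.
rewrite (bigD1 v) //= lerD //; first exact: inner.
rewrite big_distrr /=; apply: ler_sum => w /andP[wT wv].
apply: le_trans (inner w w _) _; first by move=> u uw _; rewrite adj_sym.
by rewrite ler_pM2r // hd.
Qed.
End SmallPart.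

(** * The case of [b + 1] vertices in [T] *)

Section SmallCase.
Variables (R : realType) (G H : sgraph) (c e b : nat) (T : {set G}).
Variables (T' P' Q' : {set H}) (v' : H).
Hypothesis sH : extremal_structure c e b T' P' Q' v'.
Hypotheses (conn : connected_graph G) (cGH : #|G| = #|H|) (b0 : (0 < b)%N).
Hypotheses (cT : #|T| = b.+1) (nT : (0 < #|~: T'|)%N).
Hypotheses (deg_ge : forall v, v \in T -> (c <= degree v)%N)
  (deg_sum : (\sum_(v in T) degree v <= b.+1 * c + e)%N).
Lemma card_clique_eq : #|~: T| = #|~: T'|.
Proof. by have := cardsC T; have := cardsC T'; rewrite cT (ext_cardT sH); lia. Qed.

Lemma deg_excess v : v \in T -> (degree v <= c + e)%N.
Proof.
move=> vT; move: deg_sum; rewrite (bigD1 v) //=.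
have : (b * c <= \sum_(i in T | i != v) degree i)%N.
  have -> : (b * c = \sum_(i in T | i != v) c)%N.
    rewrite sum_nat_const; congr (_ * _)%N.
    have := cardsD1 v T; rewrite vT cT => -[->].
    by apply: eq_card => u; rewrite !inE andbC.
  by apply: leq_sum => i /andP[iT _]; exact: deg_ge.
by rewrite mulSn; lia.
Qed.

Lemma sum_degree_sq : (forall v, v \in T -> degree v < c + e)%N ->
  (\sum_(v in T) degree v ^ 2 + e <= b.+1 * c ^ 2 + 2 * c * e + e ^ 2)%N.
Proof.
move=> lt_e.
have [e' eE] : exists e', e = e'.+1.
  have /card_gt0P[v vT] : (0 < #|T|)%N by rewrite cT.
  by have := lt_e v vT; have := deg_ge vT; case: (e) => [|e' _ _]; [lia | exists e'].
(* On the interval from [c] to [c + e'] the square lies below its chord; summing the chord bound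
   saves [e] against a single vertex of degree [c + e]. *)
have pt v : v \in T -> (degree v ^ 2 + (c + e') * c <= (2 * c + e') * degree v)%N.
  move=> vT; have := lt_e v vT; have [d ->] : exists d, degree v = (c + d)%N.
    by exists (degree v - c)%N; have := deg_ge vT; lia.
  rewrite eE addnS ltnS leq_add2l => de.
  have : (d * d <= d * e')%N by rewrite leq_mul2l de orbT.
  by rewrite expnS expn1; lia.
have : (\sum_(v in T) (degree v ^ 2 + (c + e') * c) <= \sum_(v in T) (2 * c + e') * degree v)%N.
  by apply: leq_sum => v; exact: pt.
rewrite big_split /= sum_nat_const cT -big_distrr /=.
have : ((2 * c + e') * \sum_(v in T) degree v <= (2 * c + e') * (b.+1 * c + e))%N.
  by rewrite leq_mul2l deg_sum orbT.
by rewrite eE !expnS !expn0; lia.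
Qed.

Lemma extremal_of_spectral_radius (l mu D : R) :
  spectral_radius R G = l -> mu = l * (l + 1) -> D = b.+1%:R * c%:R + e%:R ->
  0 < l -> 2 * D <= mu -> 2 * (c%:R + e%:R) <= l ->
  (0 < e%:R :> R ->
    c%:R * D ^+ 3 + e%:R * (c%:R + e%:R) * D * mu < e%:R * mu ^+ 2) ->
  spectral_radius R H <= l ->
  exists P Q v, @extremal_structure G c e b T P Q v.
Proof.
move=> lE muE DE l0 D_mu ce_l gap spec.
have sum_deg : \sum_(v in T) (degree v)%:R <= D :> R.
  by rewrite DE -natr_sum -natrM -natrD ler_nat.
have G0 : (0 < #|G|)%N by rewrite cGH; apply/card_gt0P; exists v'.
have [x xpos eig] := perron_connected R G0 conn; rewrite lE in eig.
pose sigma := \sum_(v | v \notin T) x v; pose Z := \sum_(v in T) x v.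
have Z0 : 0 <= Z by apply: sumr_ge0 => v _; exact: ltW.
have s0 : 0 < sigma.
  have : (0 < #|~: T|)%N by rewrite card_clique_eq.
  move=> /card_gt0P[w]; rewrite inE => wT; rewrite /sigma (bigD1 w) //=.
  by rewrite ltr_pwDl // sumr_ge0 // => v _; exact: ltW.
have [c0 e0 bp] : [/\ 0 <= c%:R :> R, 0 <= e%:R :> R & 0 < b%:R :> R].
  by rewrite !ler0n ltr0n.
have b1E : b.+1%:R = b%:R + 1 :> R by rewrite natr1.
have D0 : 0 <= D by rewrite DE addr_ge0 // mulr_ge0 // ler0n.
have mup : 0 < mu by rewrite muE mulr_gt0 ?addr_gt0.
have le_deg v : mu * x v <= (degree v)%:R * (sigma + Z).
  by rewrite muE; exact: entry_le_degree eig v.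
have cl_le := clique_part_le T xpos eig; rewrite -/sigma card_clique_eq in cl_le.
set N : R := #|~: T'|%:R in cl_le.
have ZD : mu * Z <= D * (sigma + Z).
  rewrite /Z big_distrr /=; apply: le_trans (_ : \sum_(v in T) (degree v)%:R * (sigma + Z) <= _).
    by apply: ler_sum => v _.
  by rewrite -mulr_suml ler_wpM2r ?sum_deg //; lra.
have Dmu : 0 < mu - D by lra.
(* If [e = 0], every vertex of [T] has degree [c + e], so the negative case forces [e > 0], as [gap]
   requires. *)
have [[v0 v0T dv0]|no_max] := pselect (exists2 v, v \in T & degree v = (c + e)%N); last first.
  exfalso.
  have lt_e v : v \in T -> (degree v < c + e)%N.
    move=> vT; rewrite ltn_neqAle deg_excess // andbT; apply/eqP => h.
    by apply: no_max; exists v.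
  have sq := sum_degree_sq lt_e.
  have e_gt0 : 0 < e%:R :> R.
    rewrite ltr0n; have /card_gt0P[v vT] : (0 < #|T|)%N by rewrite cT.
    by rewrite -(ltn_add2l c) addn0; exact: leq_ltn_trans (deg_ge vT) (lt_e v vT).
  (* This is [b * c ^+ 2 + (c + e) ^+ 2], the sum of squared degrees over [T'] in the extremal
     graph. *)
  pose S2 : R := b.+1%:R * c%:R ^+ 2 + 2 * c%:R * e%:R + e%:R ^+ 2.
  have sqR : \sum_(v in T) (degree v)%:R ^+ 2 <= S2 - e%:R.
    rewrite lerBrDr /S2 (eq_bigr (fun v => (degree v ^ 2)%:R)) => [|v _]; last by rewrite natrX.
    by rewrite -natr_sum -!natrX -!natrM -!natrD ler_nat.
  have dx : mu * (\sum_(w in T) (degree w)%:R * x w) <= (S2 - e%:R) * (sigma + Z).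
    rewrite big_distrr /=.
    apply: le_trans (_ : \sum_(v in T) (degree v)%:R ^+ 2 * (sigma + Z) <= _).
      by apply: ler_sum => v _; rewrite mulrCA expr2 -mulrA ler_wpM2l ?ler0n.
    by rewrite -mulr_suml ler_wpM2r //; lra.
  have S2e : 0 <= S2 - e%:R by apply: le_trans sqR; apply: sumr_ge0 => v _; exact: sqr_ge0.
  (* Both weights are eliminated, using [(mu - D) * (sigma + Z) <= mu * sigma], a rewriting of
     [ZD]. *)
  have main : (mu - D) * (l + 1 - N) <= S2 - e%:R.
    rewrite -(ler_pM2r (mulr_gt0 mup s0)).
    have h1 : mu * ((l + 1 - N) * sigma) <= (S2 - e%:R) * (sigma + Z).
      by apply: le_trans dx; rewrite ler_pM2l //; lra.
    have h2 : (mu - D) * (mu * ((l + 1 - N) * sigma)) <= (mu - D) * ((S2 - e%:R) * (sigma + Z)).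
      by rewrite ler_pM2l.
    have h3 : (S2 - e%:R) * ((mu - D) * (sigma + Z)) <= (S2 - e%:R) * (mu * sigma).
      by apply: ler_wpM2l => //; lra.
    by lra.
  (* In the equations of the extremal graph on [T'], the quantity [p + b * q] is replaced by its
     lower bound [z]. This gives explicit [p] and [q] that satisfy the required inequalities. *)
  pose z := D / mu.
  pose p := (c%:R + e%:R + c%:R * z) / mu; pose q := (c%:R + c%:R * z) / mu.
  have z0 : 0 <= z by apply: divr_ge0 => //; exact: ltW.
  have cD0 : 0 <= c%:R * z by exact: mulr_ge0.
  have p0 : 0 <= p by apply: divr_ge0; [lra | exact: ltW].
  have q0 : 0 <= q by apply: divr_ge0; [lra | exact: ltW].
  have mp : mu * p = c%:R + e%:R + c%:R * z by rewrite /p mulrC divfK // gt_eqF.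
  have mq : mu * q = c%:R + c%:R * z by rewrite /q mulrC divfK // gt_eqF.
  have pq : z <= p + b%:R * q.
    rewrite /z ler_pdivrMr // -/z.
    have -> : (p + b%:R * q) * mu = mu * p + b%:R * (mu * q) by ring.
    rewrite mp mq DE b1E.
    have : 0 <= b%:R * (c%:R * z) by apply: mulr_ge0 => //; exact: ltW.
    by lra.
  have cpq : c%:R * z <= c%:R * (p + b%:R * q) by exact: ler_wpM2l.
  have ep : 0 <= e%:R * p by exact: mulr_ge0.
  have h3 : l + 1 < N + (c + e)%:R * p + (c * b)%:R * q.
    have h4 : ((c%:R + e%:R) * p + c%:R * b%:R * q) * mu = S2 + c%:R * D * z.
      have -> : ((c%:R + e%:R) * p + c%:R * b%:R * q) * mu =
          (c%:R + e%:R) * (mu * p) + c%:R * b%:R * (mu * q) by ring.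
      by rewrite mp mq /S2 DE b1E; ring.
    have mS : l + 1 - N <= (S2 - e%:R) / (mu - D) by rewrite ler_pdivlMr // mulrC.
    (* After cross-multiplication and [S2 = c * D + e * (c + e)], the terms [c * D ^+ 2] cancel; the
       remainder, multiplied by [mu], is [gap]. *)
    have key : (S2 - e%:R) / (mu - D) < (S2 + c%:R * D * z) / mu.
      rewrite ltr_pdivrMr // mulrAC ltr_pdivlMr //.
      have zm : z * mu = D by rewrite /z divfK // gt_eqF.
      have S2E : S2 = c%:R * D + e%:R * (c%:R + e%:R) by rewrite /S2 DE b1E; ring.
      suff h5 : e%:R * (c%:R + e%:R) * D + c%:R * D ^+ 2 * z < e%:R * mu.
        have -> : (S2 + c%:R * D * z) * (mu - D) =
            S2 * mu - S2 * D + c%:R * D * (z * mu) - c%:R * D ^+ 2 * z by ring.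
        by rewrite zm S2E; lra.
      rewrite -(ltr_pM2r mup).
      have -> : (e%:R * (c%:R + e%:R) * D + c%:R * D ^+ 2 * z) * mu =
          c%:R * D ^+ 2 * (z * mu) + e%:R * (c%:R + e%:R) * D * mu by ring.
      by rewrite zm -mulrA -exprSr -[e%:R * mu * mu]mulrA -expr2 gap.
    rewrite natrD natrM -addrA -ltrBlDl.
    apply: le_lt_trans (_ : _ <= (S2 - e%:R) / (mu - D)) _; first by lra.
    by rewrite -(ltr_pM2r mup) h4 -ltr_pdivlMr.
  have h1 : l * (l + 1) * p <= (c + e)%:R * (1 + p) + (c * b)%:R * q.
    by rewrite -muE natrD natrM mp; lra.
  have h2 : l * (l + 1) * q <= c%:R * (1 + p + b%:R * q) by rewrite -muE mq; lra.
  have [_ _ /(_ h3)] := extremal_subinvariant sH (ltW l0) p0 q0 nT h1 h2 (ltW h3).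
  by rewrite ltNge spec.
pose x0 := x v0; pose Qs := \sum_(w in T | w != v0) x w.
have ZE : Z = x0 + Qs by rewrite /Z (bigD1 v0).
have others w : w \in T -> w != v0 -> degree w = c.
  move=> wT wv; apply/eqP; rewrite eqn_leq deg_ge // andbT.
  move: deg_sum; rewrite (bigD1 v0) //= dv0 (bigD1 w) /= ?wT //.
  rewrite (eq_bigl (mem (T :\ v0 :\ w))) => [|i]; last first.
    by rewrite !inE; case: (i == w); case: (i == v0); case: (i \in T).
  have : ((b - 1) * c <= \sum_(i in T :\ v0 :\ w) degree i)%N.
    have -> : ((b - 1) * c = \sum_(i in T :\ v0 :\ w) c)%N.
      rewrite sum_nat_const; congr (_ * _)%N.
      have := cardsD1 v0 T; have := cardsD1 w (T :\ v0); rewrite !inE wv wT v0T cT /=.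
      by move=> -> /eqP; rewrite !add1n => /eqP[->]; rewrite subn1.
    by apply: leq_sum => i; rewrite !inE => /and3P[_ _ iT]; exact: deg_ge.
  have -> : (b.+1 * c = c + c + (b - 1) * c)%N.
    by case: (b) b0 => // b' _; rewrite subn1 /= !mulSn addnA.
  move: (degree w) (\sum_(_ in _) _)%N ((b - 1) * c)%N; clear.
  by move=> dw s r; lia.
have x0p : 0 < x0 by exact: xpos.
have [v1 v1T v1v0] : exists2 v1, v1 \in T & v1 != v0.
  have /card_gt0P[v1] : (0 < #|T :\ v0|)%N by have := cardsD1 v0 T; rewrite v0T cT add1n => -[<-].
  by rewrite !inE => /andP[]; exists v1.
have Qp : 0 < Qs.
  rewrite /Qs (bigD1 v1) ?v1T //= ltr_pwDl // sumr_ge0 // => w _; exact: ltW.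
(* From [ZD] and [2 * D <= mu]. Together with [2 * (c + e) <= l] it yields [Tle], the premise of
   [entry_le_codegree]. *)
have ZS : Z <= sigma by nra.
have Tle u : u \in T -> (l + 1) * x u <= sigma.
  move=> uT; have : mu * x u <= (c%:R + e%:R) * (2 * sigma).
    apply: le_trans (le_deg u) _; apply: ler_pM; rewrite ?ler0n //; [lra | | lra].
    by rewrite -natrD ler_nat deg_excess.
  rewrite muE -mulrA => h; rewrite -(ler_pM2l l0); apply: le_trans h _.
  by rewrite mulrCA mulrA ler_pM2r.
have f1 : mu * x0 <= (c%:R + e%:R) * (sigma + x0) + c%:R * Qs.
  rewrite muE -natrD -dv0; apply: entry_le_codegree => // w wT wv.
  by rewrite others.
have f2 w : w \in T -> w != v0 -> mu * x w <= c%:R * (sigma + Z).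
  by move=> wT wv; have := le_deg w; rewrite others.
have cb : (#|[pred w in T | w != v0]| = b)%N.
  have := cardsD1 v0 T; rewrite v0T cT => -[->]; apply: eq_card => w.
  by rewrite !inE andbC.
have dsum : \sum_(w in T) (degree w)%:R * x w = (c%:R + e%:R) * x0 + c%:R * Qs.
  rewrite (bigD1 v0) //= dv0 natrD; congr (_ + _).
  by rewrite /Qs big_distrr /=; apply: eq_bigr => w /andP[wT wv]; rewrite others.
(* The weights of [G] are normalised by [sigma], and those on [T] other than [v0] are averaged. *)
pose p := x0 / sigma; pose q := Qs / (b%:R * sigma).
have p0 : 0 <= p by rewrite divr_ge0 // ltW.
have q0 : 0 < q by rewrite divr_gt0 // mulr_gt0.
have sp : sigma * p = x0 by rewrite /p mulrC divfK // gt_eqF.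
have sq : b%:R * sigma * q = Qs by rewrite /q mulrC divfK // gt_eqF // mulr_gt0.
have h1 : l * (l + 1) * p <= (c + e)%:R * (1 + p) + (c * b)%:R * q.
  rewrite -muE natrD natrM -(ler_pM2l s0); move: f1; rewrite -sp -sq; lra.
have Qle : mu * Qs <= b%:R * (c%:R * (sigma + Z)).
  rewrite mulr_natl -cb -sumr_const /Qs big_distrr /=.
  by apply: ler_sum => w /andP[]; exact: f2.
have h2 : l * (l + 1) * q <= c%:R * (1 + p + b%:R * q).
  rewrite -muE -(ler_pM2l (mulr_gt0 bp s0)); move: Qle; rewrite ZE -sp -sq; lra.
have h3 : l + 1 <= #|~: T'|%:R + (c + e)%:R * p + (c * b)%:R * q.
  rewrite natrD natrM -(ler_pM2l s0); move: cl_le; rewrite dsum -/N -sp -sq; lra.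
have [_ strict2 strict3] := extremal_subinvariant sH (ltW l0) p0 (ltW q0) nT h1 h2 h3.
have eq3 : (l + 1) * sigma = #|~: T|%:R * sigma + \sum_(w in T) (degree w)%:R * x w.
  rewrite card_clique_eq -/N; apply/eqP; rewrite eq_le cl_le /= leNgt; apply/negP => h.
  suff : l < spectral_radius R H by rewrite ltNge spec.
  apply: strict3; rewrite natrD natrM -(ltr_pM2l s0); move: h; rewrite dsum -/N -sp -sq; lra.
have eq2 : mu * Qs = b%:R * (c%:R * (sigma + Z)).
  apply/eqP; rewrite eq_le Qle /= leNgt; apply/negP => h.
  suff : l < spectral_radius R H by rewrite ltNge spec.
  apply: strict2 => //; rewrite -muE -(ltr_pM2l (mulr_gt0 bp s0)).
  by move: h; rewrite ZE -sp -sq; lra.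
have eqw w : w \in T -> w != v0 -> mu * x w = (degree w)%:R * (sigma + Z).
  move=> wT wv; rewrite others //.
  have : \sum_(w in T | w != v0) (c%:R * (sigma + Z) - mu * x w) = 0.
    by rewrite sumrB sumr_const cb -big_distrr /= -/Qs eq2 -[X in X - _]mulr_natl subrr.
  move/eqP; rewrite psumr_eq0 => [|i /andP[iT iv]]; last by rewrite subr_ge0 f2.
  by move/allP/(_ w (mem_index_enum _)); rewrite wT wv /= subr_eq0 => /eqP.
(* Each neighbour of such a [w] is adjacent to all other vertices. Hence all these [w], having equal
   degree [c], share one neighbourhood [P], and [v0] is joined to [P] as well. *)
have univ w u y : w \in T -> w != v0 -> adj w u -> y != u -> adj u y.
  move=> wT wv wu yu; have := eqw w wT wv; rewrite muE => h.
  exact: (entry_eq_degree xpos eig h wu yu).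
have [clq ind] := clique_part_eq xpos eig eq3.
pose P := [set u | adj v1 u]; pose Q := [set u | adj v0 u] :\: P.
have PT u : u \in P -> u \notin T by rewrite inE => v1u; apply: contraTN v1u => uT; rewrite ind.
have Pv0 : P \subset [set u | adj v0 u].
  apply/fintype.subsetP => u uP; rewrite inE adj_sym (univ v1) //.
    by move: uP; rewrite inE.
  by apply: contraNneq (PT u uP) => <-.
have NP w : w \in T -> w != v0 -> [set u | adj w u] = P.
  move=> wT wv; apply/esym/eqP; rewrite eqEcard.
  have -> : #|[set u | adj w u]| = c by exact: others.
  have -> : #|P| = c by exact: others.
  rewrite leqnn andbT; apply/fintype.subsetP => u uP; rewrite inE adj_sym (univ v1) //.
    by move: uP; rewrite inE.
  by apply: contraNneq (PT u uP) => <-.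
exists P, Q, v0; split=> //.
- exact: others.
- rewrite cardsD (finset.setIidPr Pv0); have -> : #|P| = c by exact: others.
  by have : degree v0 = (c + e)%N by []; rewrite /degree => ->; rewrite addKn.
- by rewrite disjoint_subset; apply/fintype.subsetP => u /PT.
- rewrite disjoint_subset; apply/fintype.subsetP => u; rewrite !inE => /andP[_ v0u].
  by apply: contraTN v0u => uT; rewrite ind.
- by rewrite disjoint_sym disjoint_subset; apply/fintype.subsetP => u; rewrite !inE => /andP[].
move=> w y wT yT; case: (eqVneq w v0) => [->|wv] /=.
  have /fintype.subsetP/(_ y) := Pv0; rewrite !inE.
  by case: (adj v1 y) => [->|_].
by rewrite orbF; have /setP/(_ y) := NP w wT wv; rewrite !inE.
Qed.
End SmallCase.

Theorem theorem1p9 (R : realType) (a b k n : nat) (G : sgraph)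
    (ha : (1 <= a)%N) (hab : (a <= b)%N)
    (hconn : connected_graph G) (hcard : #|G| = n)
    (hn : (2 * (b + a + k + 2) * (b + k + 2) <= n)%N)
    (hdeg : (a + k <= min_degree G)%N)
    (hspec : (spectral_radius R (extremal_graph n a b k)
              <= spectral_radius R G)%R) :
  fractional_critical R a b k G \/ graph_iso G (extremal_graph n a b k).
Proof.
have [crit|ncrit] := pselect (fractional_critical R a b k G); [by left | right].
have n_large : (2 * (b + a + k + 2) <= n)%N.
  by apply: leq_trans hn; rewrite leq_pmulr // addn2.
have [cH [T' [P' [Q' [v' sH]]]]] := @extremal_graph_structure n a b k ha ltac:(lia).
have cC' : #|~: T'| = (n - b.+1)%N by have := cardsC T'; rewrite cH (ext_cardT sH); lia.
have nT' : (0 < #|~: T'|)%N by rewrite cC'; lia.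
have G0 : (0 < #|G|)%N by rewrite hcard; lia.
have deg_ge v : (a + k <= @degree G v)%N := leq_trans hdeg (degree_ge_min_degree v).
have l_ge : (n - (b + 2))%:R <= spectral_radius R G.
  apply: le_trans hspec; apply: le_trans (extremal_spectral_radius_ge R sH nT').
  by rewrite lerBrDr natr1 cC' ler_nat; lia.
have [T [s [hT hs viol]]] := not_critical_witness hab ncrit.
rewrite hcard in hT.
have bT : (b < #|T|)%N.
  have : (#|T| * (a + k) <= \sum_(v in T) degree v)%N.
    by rewrite -sum_nat_const; apply: leq_sum.
  have : (b * s < #|T| * s -> b < #|T|)%N by rewrite ltn_mul2r => /andP[].
  move: viol; move: (\sum_(v in T) _)%N #|T| => d t; clear.
  by move=> h1 h2 h3; apply: h2; lia.
case: (leqP (b + 2) #|T|) => [bT2|]; last rewrite addn2 ltnS => Tb.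
  have deg_gt0 v : (0 < @degree G v)%N by apply: leq_trans (deg_ge v); rewrite addn_gt0 ha.
  have sq := spectral_radius_sq_le R G0 deg_gt0.
  have := @large_independent_part_arith a b k n #|T| s ha hab hn hT hs bT2.
  have := sum_degree_le T; rewrite hcard in sq *.
  have : ((n - (b + 2)) ^ 2 + (n - 1) <= \sum_(v : G) degree v)%N.
    rewrite -(ler_nat R) natrD natrX (le_trans _ sq) // lerD2r.
    by rewrite ler_pXn2r ?nnegrE ?ler0n // (le_trans _ l_ge) ?ler0n.
  move: viol; set d := (\sum_(v in T) _)%N; set d' := (\sum_v _)%N.
  set m1 := (_ * (_ - 1))%N; set m2 := ((_ + _) * #|T|)%N; set m3 := (_ ^ 2)%N.
  by move: d d' m1 m2 m3 (b * s)%N; clear; lia.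
have cT : #|T| = b.+1 by apply/eqP; rewrite eqn_leq Tb bT.
have deg_sum : (\sum_(v in T) degree v <= b.+1 * (a + k) + (a - 1))%N.
  (* Here [b * s < a * (b + 1) <= b * (a + 1)]. With [s <= a], [viol] bounds the total excess over
     [a + k] by [s - 1 <= a - 1]. *)
  have sa : (s <= a)%N.
    rewrite -ltnS -(ltn_pmul2l (leq_trans ha hab)); apply: leq_trans hs _.
    by rewrite cT !mulnS [(b * a)%N]mulnC leq_add2r.
  move: viol; rewrite cT; move: (\sum_(v in T) _)%N => d h.
  suff : (d + b * s + 1 <= s + b * s + b.+1 * (a + k))%N by move: (b * s)%N; lia.
  by rewrite addn1; apply: leq_trans h _; lia.
have [l0 h1 h2 gap] := spectral_gap_arith ha hab hn l_ge.
have [P [Q [v sG]]] := extremal_of_spectral_radius (R := R) sH hconn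
  (etrans hcard (esym cH)) (leq_trans ha hab) cT nT' (fun v _ => deg_ge v) deg_sum
  erefl erefl erefl l0 h1 h2 gap hspec.
exact: extremal_structure_iso (etrans hcard (esym cH)) sG sH.
Qed.
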